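(* Let $n\geq 2$ be an integer and let $A$ be an abelian group. Then there is an isomorphism of abelian groups $$\mathrm{Tor}^{[n]}(A)\;\simeq\;\varprojlim\,\bigl(F^{\otimes n}/H^{\otimes n}\bigr),$$ where the inverse limit is taken over the category ${\sf Fext}_{\sf Ab}(A)$ of free extensions $H\rightarrowtail F\twoheadrightarrow A$ of $A$ in the category of abelian groups, i.e. it is the limit of the functor ${\sf Fext}_{\sf Ab}(A)\to{\sf Ab}$ sending $H\rightarrowtail F\twoheadrightarrow A$ to $F^{\otimes n}/H^{\otimes n}$.
   Context: ${\sf Ab}$ is the category of abelian groups; tensor products are over $\mathbb Z$, and $B^{\otimes n}$ is the $n$-fold tensor power. The category ${\sf Fext}_{\sf Ab}(A)$: objects are short exact sequences $H\rightarrowtail F\twoheadrightarrow A$ of abelian groups with $F$ free abelian; morphisms from $(H_1\rightarrowtail F_1\twoheadrightarrow A)$ to $(H_2\rightarrowtail F_2\twoheadrightarrow A)$ are morphisms of short exact sequences (commutative diagrams) $H_1\to H_2$, $F_1\to F_2$ inducing the identity on $A$. For such an extension, $H^{\otimes n}$ is viewed as a subgroup of $F^{\otimes n}$ (all groups involved being free abelian), and a morphism of extensions induces a homomorphism $F_1^{\otimes n}/H_1^{\otimes n}\to F_2^{\otimes n}/H_2^{\otimes n}$. For a functor $\mathfrak F:{\sf C}\to{\sf Ab}$, $\varprojlim\mathfrak F$ is the group of families $(x_c)_{c\in {\sf C}}$, $x_c\in\mathfrak F(c)$, which are compatible: $\mathfrak F(a)(x_c)=x_{c'}$ for every morphism $a:c\to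 c'$ in ${\sf C}$. For abelian groups $B_1,\dots,B_n$, $\mathrm{Tor}_i(B_1,\dots,B_n)$ denotes the $i$-th homology group of the complex $P_1\otimes\cdots\otimes P_n$, where $P_j$ is a $\mathbb Z$-flat resolution of $B_j$. For $n\ge 2$, $\mathrm{Tor}^{[n]}(A):=\mathrm{Tor}_{n-1}(A,\dots,A)$ ($n$ copies of $A$). *)

(* Defs.v *)
From HB Require Import structures.
From mathcomp Require Import all_boot all_order all_algebra.
From mathcomp Require Import boolp.
From mathcomp Require Import freeg.

Set Implicit Arguments.
Unset Strict Implicit.
Unset Printing Implicit Defensive.

Import GRing.Theory.
Local Open Scope ring_scope.
Local Open Scope quotient_scope.

Section Subgroups.
Variables U V : zmodType.

Definition addkernel (f : {additive U -> V}) : {pred U} := fun u => f u == 0.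

Lemma addkernel_zmod_closed f : zmod_closed (addkernel f).
Proof.
split=> [|x y]; rewrite /in_mem /= /addkernel ?raddf0 //.
by move=> /eqP fx /eqP fy; rewrite raddfB fx fy subrr.
Qed.
HB.instance Definition _ f := GRing.isZmodClosed.Build U (addkernel f)
  (addkernel_zmod_closed f).

Definition addimage (f : {additive U -> V}) : {pred V} :=
  fun v => `[< exists u, f u = v >].

Lemma addimage_zmod_closed f : zmod_closed (addimage f).
Proof.
split=> [|x y]; first by apply/asboolP; exists 0; rewrite raddf0.
move=> /asboolP[u <-] /asboolP[v <-]; apply/asboolP; exists (u - v).
by rewrite raddfB.
Qed.
HB.instance Definition _ f := GRing.isZmodClosed.Build V (addimage f)
  (addimage_zmod_closed f).

End Subgroups.

Section Generated.
Variables (V : zmodType) (S : V -> Prop).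

Inductive spanned : V -> Prop :=
| span_gen v of S v : spanned v
| span0 : spanned 0
| spanB u v of spanned u & spanned v : spanned (u - v).

Definition generated : {pred V} := fun v => `[< spanned v >].

Lemma generated_zmod_closed : zmod_closed generated.
Proof.
split=> [|x y]; first by apply/asboolP/span0.
by move=> /asboolP Sx /asboolP Sy; apply/asboolP/spanB.
Qed.
HB.instance Definition _ := GRing.isZmodClosed.Build V generated
  generated_zmod_closed.

End Generated.

Section QuotientMap.
Variables (V W : zmodType) (I : zmodClosed V).

Lemma repr_quotB (x : V) : repr (\pi_(Quotient.quot I) x) - x \in I.
Proof. by rewrite Quotient.idealrBE reprK. Qed.

Lemma factor_pi (g : {additive V -> W}) (gI : forall x, x \in I -> g x = 0) x :
  g (repr (\pi_(Quotient.quot I) x)) = g x.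
Proof. by apply/eqP; rewrite -subr_eq0 -raddfB gI ?repr_quotB. Qed.

End QuotientMap.

Section TensorProduct.
Variable I : finType.

Section Def.
Variable B : I -> zmodType.

(* The tensor product over int of a finite family (B i) is the free abelian
   group on the tuples in \prod_i B i modulo multiadditivity, that is, the
   relations [.., y + z, ..] - [.., y, ..] - [.., z, ..] for tuples
   which agree outside an index i. *)
Inductive tens_rel : {freeg {dffun forall i, B i}} -> Prop :=
| TensRel (i : I) (x y z : {dffun forall i, B i}) of
    x i = y i + z i
  & (forall j, j != i -> x j = y j)
  & (forall j, j != i -> x j = z j) :
  tens_rel (<< x >> - << y >> - << z >>).

Definition tens : Type := {ideal_quot generated tens_rel}.
HB.instance Definition _ := GRing.Zmodule.on tens.

Definition tpi : {freeg {dffun forall i, B i}} -> tens :=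
  \pi_({ideal_quot generated tens_rel}).

Lemma tpi_is_zmod_morphism : zmod_morphism tpi.
Proof. exact: raddfB. Qed.
HB.instance Definition _ := GRing.isZmodMorphism.Build _ _ tpi
  tpi_is_zmod_morphism.

Definition tpure (x : {dffun forall i, B i}) : tens := tpi << x >>.

Lemma tpure_add i (x y z : {dffun forall i, B i}) :
  x i = y i + z i -> (forall j, j != i -> x j = y j) ->
  (forall j, j != i -> x j = z j) -> tpure x = tpure y + tpure z.
Proof.
move=> xi xy xz; apply/eqP; rewrite -subr_eq0 opprD addrA -!raddfB.
rewrite -(raddf0 tpi) -Quotient.idealrBE subr0.
by apply/asboolP/span_gen; apply: (TensRel xi).
Qed.

Lemma tpure0 (x : {dffun forall i, B i}) i : x i = 0 -> tpure x = 0.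
Proof.
move=> xi; have xD : x i = x i + x i by rewrite xi addr0.
apply: (@addrI _ (tpure x)); rewrite addr0.
by rewrite -(tpure_add xD).
Qed.

Lemma tens_ext (V : zmodType) (f g : {additive tens -> V}) :
  (forall x, f (tpure x) = g (tpure x)) -> f =1 g.
Proof.
move=> fg x; rewrite -[x]reprK -/(tpi _) -[repr x]freeg_sumE !raddf_sum.
apply: eq_bigr => z _; rewrite -[coeff z _]intz -freegU_mulz !raddfMz.
by rewrite -/(tpure z) fg.
Qed.

End Def.

Section Lift.
Variables (B : I -> zmodType) (V : zmodType) (g : {dffun forall i, B i} -> V).

Definition fgliftz : {freeg {dffun forall i, B i}} -> V :=
  fglift (g : {dffun forall i, B i} -> zmodule V).

Lemma fgliftz_is_zmod_morphism : zmod_morphism fgliftz.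
Proof. by move=> x y; apply: (@lift_is_additive int _ (zmodule V) g). Qed.
HB.instance Definition _ := GRing.isZmodMorphism.Build _ _ fgliftz
  fgliftz_is_zmod_morphism.

Lemma fgliftzU x : fgliftz << x >> = g x.
Proof. by rewrite /fgliftz liftU scale1r. Qed.

Hypothesis g_add : forall i (x y z : {dffun forall i, B i}),
  x i = y i + z i -> (forall j, j != i -> x j = y j) ->
  (forall j, j != i -> x j = z j) -> g x = g y + g z.

Lemma fgliftz_rel x : x \in generated (@tens_rel B) -> fgliftz x = 0.
Proof.
move=> /asboolP; elim=> [_ [i y z w yi yz yw]||u v _ u0 _ v0].
- by rewrite !raddfB /= !fgliftzU (g_add yi) // (addrC (g z)) addrK subrr.
- exact: raddf0.
- by rewrite raddfB /= u0 v0 subrr.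
Qed.

Definition tlift (x : tens B) : V := fgliftz (repr x).

Lemma tlift_pi x : tlift (tpi x) = fgliftz x.
Proof. exact: factor_pi fgliftz_rel x. Qed.

End Lift.

Section Map.
Variables (B C : I -> zmodType) (f : forall i, {additive B i -> C i}).

Definition tens_map : tens B -> tens C :=
  tlift (fun x : {dffun forall i, B i} =>
    tpure ([ffun i => f i (x i)] : {dffun forall i, C i})).

Let tens_map_add i (x y z : {dffun forall i, B i}) :
  x i = y i + z i -> (forall j, j != i -> x j = y j) ->
  (forall j, j != i -> x j = z j) ->
  tpure ([ffun i => f i (x i)] : {dffun forall i, C i}) =
  tpure ([ffun i => f i (y i)] : {dffun forall i, C i}) +
  tpure ([ffun i => f i (z i)] : {dffun forall i, C i}).
Proof.
move=> xi xy xz; apply: (@tpure_add _ i); first by rewrite !ffunE xi raddfD.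
- by move=> j ji; rewrite !ffunE xy.
- by move=> j ji; rewrite !ffunE xz.
Qed.

Lemma tens_map_pure x :
  tens_map (tpure x) = tpure ([ffun i => f i (x i)] : {dffun forall i, C i}).
Proof. by rewrite /tens_map tlift_pi ?fgliftzU //; apply: tens_map_add. Qed.

Lemma tens_map_is_zmod_morphism : zmod_morphism tens_map.
Proof.
move=> x y; rewrite -[x]reprK -[y]reprK -!/(tpi _) -raddfB.
by rewrite /tens_map !tlift_pi ?raddfB //; apply: tens_map_add.
Qed.
HB.instance Definition _ := GRing.isZmodMorphism.Build _ _ tens_map
  tens_map_is_zmod_morphism.

Lemma tens_map0 i : (forall x, f i x = 0) -> forall x, tens_map x = 0.
Proof.
move=> fi0; apply: (tens_ext (f := tens_map) (g := \0)) => x.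
by rewrite /= tens_map_pure (@tpure0 _ _ i) // ffunE.
Qed.

End Map.

Lemma tens_map_comp (B C D : I -> zmodType)
    (g : forall i, {additive C i -> D i}) (f : forall i, {additive B i -> C i})
    (h : forall i, {additive B i -> D i}) :
  (forall i x, g i (f i x) = h i x) ->
  forall x, tens_map g (tens_map f x) = tens_map h x.
Proof.
move=> gf; apply: (tens_ext (f := tens_map g \o tens_map f)) => x /=.
rewrite !tens_map_pure; congr tpure; apply/ffunP => i.
by rewrite !ffunE gf.
Qed.

End TensorProduct.

Record chain_complex := ChainComplex {
  chain :> nat -> zmodType;
  diff : forall k, {additive chain k.+1 -> chain k};
  diff_diff : forall k x, diff k (diff k.+1 x) = 0
}.

Section Homology.
Variable C : chain_complex.

(* The differential out of degree k; it vanishes in degree 0. *)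
Definition bd k : {additive C k -> C k.-1} :=
  match k return {additive C k -> C k.-1} with
  | 0 => \0
  | k'.+1 => diff C k'
  end.

Definition cycles k : Type := {x : C k | x \in addkernel (bd k)}.
HB.instance Definition _ k := SubChoice.on (cycles k).
HB.instance Definition _ k := [SubChoice_isSubZmodule of cycles k by <:].

Definition boundaries k : {pred cycles k} :=
  fun z => val z \in addimage (diff C k).

Lemma boundaries_zmod_closed k : zmod_closed (@boundaries k).
Proof.
split=> [|x y]; rewrite /in_mem /= /boundaries; first by rewrite raddf0 rpred0.
by move=> Bx By; rewrite raddfB rpredB.
Qed.
HB.instance Definition _ k := GRing.isZmodClosed.Build (cycles k)
  (@boundaries k) (boundaries_zmod_closed k).

Definition homology k : zmodType := {ideal_quot @boundaries k}.

(* Identity and differential between arbitrary degrees: [degid i j] is the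
   identity if i = j and 0 otherwise, [cdiff i j] is the differential if
   i = j + 1 and 0 otherwise. *)
Definition degid_fun i j (x : C i) : C j := dfwith (fun k => 0 : C k) x j.

Lemma degid_eq i (x : C i) : degid_fun i x = x.
Proof. exact: dfwith_in. Qed.

Lemma degid_neq i j (x : C i) : i != j -> degid_fun j x = 0.
Proof. exact: dfwith_out. Qed.

Lemma degid_is_zmod_morphism i j : zmod_morphism (@degid_fun i j).
Proof.
move=> x y; have [<-|ij] := eqVneq i j; first by rewrite !degid_eq.
by rewrite !degid_neq // subr0.
Qed.
HB.instance Definition _ i j := GRing.isZmodMorphism.Build (C i) (C j)
  (@degid_fun i j) (@degid_is_zmod_morphism i j).

Definition degid i j : {additive C i -> C j} := @degid_fun i j.

Definition cdiff i j : {additive C i -> C j} := degid i.-1 j \o bd i.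

Lemma cdiffS i (x : C i.+1) : cdiff i.+1 i x = diff C i x.
Proof. exact: degid_eq. Qed.

Lemma cdiff_neq i j (x : C i) : i != j.+1 -> cdiff i j x = 0.
Proof.
case: i x => [|i] x ij; first exact: raddf0.
by apply: degid_neq; rewrite -eqSS.
Qed.

Lemma cdiff_cdiff i j k (x : C i) : cdiff j k (cdiff i j x) = 0.
Proof.
have [ij|/cdiff_neq->] := eqVneq i j.+1; last exact: raddf0.
have [jk|/cdiff_neq->//] := eqVneq j k.+1.
by subst i j; rewrite !cdiffS diff_diff.
Qed.

Lemma degid_cdiff i j k (x : C i) :
  j = k -> degid j k (cdiff i j x) = cdiff i k x.
Proof. by move=> <-; apply: degid_eq. Qed.

Lemma cdiff_degid i j k (x : C i) :
  j = k.+1 -> cdiff j k (degid i j x) = cdiff i k x.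
Proof.
move=> ->; have [<-|ij] := eqVneq i k.+1.
  by apply: congr1; apply: degid_eq.
rewrite (@cdiff_neq i) // (_ : degid i k.+1 x = 0) ?raddf0 //.
exact: degid_neq.
Qed.

Lemma degid_degid i j k (x : C i) :
  j = k -> degid j k (degid i j x) = degid i k x.
Proof. by move=> <-; apply: degid_eq. Qed.

End Homology.

Section DirectSum.
Variables (I : finType) (T : I -> zmodType).

Definition dsum : Type := {dffun forall i, T i}.
HB.instance Definition _ := Choice.on dsum.
Implicit Types f g : dsum.

Definition dsum_zero : dsum := [ffun i => 0].
Definition dsum_opp f : dsum := [ffun i => - f i].
Definition dsum_add f g : dsum := [ffun i => f i + g i].

Lemma dsum_addA : associative dsum_add.
Proof. by move=> f g h; apply/ffunP => i; rewrite !ffunE addrA. Qed.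
Lemma dsum_addC : commutative dsum_add.
Proof. by move=> f g; apply/ffunP => i; rewrite !ffunE addrC. Qed.
Lemma dsum_add0 : left_id dsum_zero dsum_add.
Proof. by move=> f; apply/ffunP => i; rewrite !ffunE add0r. Qed.
Lemma dsum_addN : left_inverse dsum_zero dsum_opp dsum_add.
Proof. by move=> f; apply/ffunP => i; rewrite !ffunE addNr. Qed.
HB.instance Definition _ := GRing.isZmodule.Build dsum
  dsum_addA dsum_addC dsum_add0 dsum_addN.

Lemma dsumBE f g i : (f - g) i = f i - g i.
Proof. by rewrite !ffunE. Qed.

End DirectSum.

Section TensorComplex.
Variables (n : nat) (P : 'I_n -> chain_complex).

(* The tensor product of n complexes is formed in one step rather than by
   iterating the binary one: its degree k part is the direct sum, over the
   multidegrees m of total degree k, of the n-fold tensor products of the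
   groups P i (m i).  A multidegree of total degree k has all its entries
   below k.+1. *)
Definition multideg k := {m : {ffun 'I_n -> 'I_k.+1} | (\sum_i m i == k)%N}.

Definition mdeg k (m : multideg k) (i : 'I_n) : nat := val m i.

Definition tens_chain k : zmodType :=
  dsum (fun m : multideg k => tens (fun i => P i (mdeg m i))).

(* The component of the differential from multidegree m to multidegree m' in
   the j-th direction; by the definitions of degid and cdiff it is nonzero only
   if m' is m decreased by one at j. *)
Definition tens_diff_entry k k' (m : multideg k) (m' : multideg k') j :
    {additive tens (fun i => P i (mdeg m i)) ->
              tens (fun i => P i (mdeg m' i))} :=
  tens_map (fun i => if i == j then cdiff (P i) (mdeg m i) (mdeg m' i)
                     else degid (P i) (mdeg m i) (mdeg m' i)).

(* d(x_0 (x) .. (x) x_(n-1)) is the sum over j of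
   (-1)^(|x_0| + .. + |x_(j-1)|) x_0 (x) .. (x) d x_j (x) .. (x) x_(n-1). *)
Definition koszul_sign k (m : multideg k) (j : 'I_n) : int :=
  (-1) ^+ (\sum_(i < n | i < j) mdeg m i)%N.

Definition tens_diff_fun k (x : tens_chain k.+1) : tens_chain k :=
  [ffun m' => \sum_m \sum_j tens_diff_entry m m' j (x m) *~ koszul_sign m j].

Lemma tens_diff_is_zmod_morphism k : zmod_morphism (@tens_diff_fun k).
Proof.
move=> x y; apply/ffunP => m'; rewrite dsumBE !ffunE -sumrB.
apply: eq_bigr => m _; rewrite -sumrB; apply: eq_bigr => j _.
by rewrite dsumBE raddfB mulrzBl.
Qed.
HB.instance Definition _ k := GRing.isZmodMorphism.Build _ _
  (@tens_diff_fun k) (@tens_diff_is_zmod_morphism k).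

Definition tens_diff k : {additive tens_chain k.+1 -> tens_chain k} :=
  @tens_diff_fun k.

Lemma tens_diff_entry_neq k k' (m : multideg k) (m' : multideg k') j i x :
  mdeg m i != (mdeg m' i + (i == j))%N -> tens_diff_entry m m' j x = 0.
Proof.
move=> mm'; apply: (@tens_map0 _ _ _ _ i) => {}x.
case: (i == j) mm' => /= mm'.
  by apply: cdiff_neq; rewrite -addn1.
by apply: degid_neq; rewrite -[mdeg m' i]addn0.
Qed.

(* The factors to the left of the j-th one have the same degrees in m and m'. *)
Lemma koszul_sign_entry k k' (m : multideg k) (m' : multideg k') j x :
  tens_diff_entry m m' j x *~ koszul_sign m j =
  tens_diff_entry m m' j x *~ koszul_sign m' j.
Proof.
have [/existsP[i mm']|] :=
  boolP [exists i, mdeg m i != (mdeg m' i + (i == j))%N].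
  by rewrite (tens_diff_entry_neq _ mm') !mul0rz.
move=> /existsPn mm'; congr (_ *~ (-1) ^+ _); apply: eq_bigr => i ij.
have /negPn/eqP-> := mm' i.
by rewrite -val_eqE /= ltn_eqF // addn0.
Qed.

Lemma mdeg_up_lt k (m : multideg k) i (b : bool) : (mdeg m i + b < k.+2)%N.
Proof.
have mi : (mdeg m i < k.+1)%N by apply: ltn_ord.
by case: b; rewrite ?addn1 ?addn0 // leqW.
Qed.

Definition multideg_up_val k (m : multideg k) j : {ffun 'I_n -> 'I_k.+2} :=
  [ffun i => inord (mdeg m i + (i == j))].

Lemma multideg_up_subproof k (m : multideg k) j :
  (\sum_i multideg_up_val m j i == k.+1)%N.
Proof.
rewrite (eq_bigr (fun i => mdeg m i + (i == j)))%N; last first.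
  by move=> i _; rewrite ffunE inordK // mdeg_up_lt.
rewrite big_split /= (eqP (valP m)) -[X in _ == X]addn1 eqn_add2l.
by rewrite (bigD1 j) //= eqxx big1 // => i /negPf->.
Qed.

Definition multideg_up k (m : multideg k) j : multideg k.+1 :=
  exist _ (multideg_up_val m j) (multideg_up_subproof m j).

Lemma mdeg_up k (m : multideg k) j i :
  mdeg (multideg_up m j) i = (mdeg m i + (i == j))%N.
Proof.
by rewrite {1}/mdeg ffunE inordK // mdeg_up_lt.
Qed.

Lemma mdeg_inj k (m m' : multideg k) :
  (forall i, mdeg m i = mdeg m' i) -> m = m'.
Proof. by move=> mm'; apply/val_inj/ffunP => i; apply/val_inj/mm'. Qed.

Lemma sum_alternating (V : zmodType) (T : 'I_n -> 'I_n -> V) :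
  (forall i, T i i = 0) -> (forall i j, i != j -> T i j = - T j i) ->
  \sum_i \sum_j T i j = 0.
Proof.
move=> T0 TN.
have -> : \sum_i \sum_j T i j =
  \sum_(i < n) (\sum_(j < n | (j < i)%N) T i j +
                \sum_(j < n | (i < j)%N) T i j).
  apply: eq_bigr => i _; rewrite (bigID (fun j : 'I_n => (j < i)%N)) /=.
  congr (_ + _); rewrite (bigD1 i) ?ltnn //= T0 add0r.
  by apply: eq_bigl => j; rewrite -leqNgt (ltn_neqAle i) andbC eq_sym.
rewrite big_split /= [X in _ + X](exchange_big_dep predT) //= -big_split /=.
apply: big1 => i _; rewrite -big_split /=; apply: big1 => j ji.
by rewrite (TN i j) ?addNr // -val_eqE gtn_eqF.
Qed.

Lemma tens_diff_diff k x : tens_diff k (tens_diff k.+1 x) = 0.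
Proof.
apply/ffunP => p; rewrite [LHS]ffunE [RHS]ffunE.
pose T (m : multideg k.+2) j' j := tens_diff_entry (multideg_up p j') p j'
  (tens_diff_entry m (multideg_up p j') j (x m))
  *~ (koszul_sign (multideg_up p j') j * koszul_sign p j').
transitivity (\sum_m \sum_j' \sum_j T m j' j).
  rewrite exchange_big /= [RHS]exchange_big /=; apply: eq_bigr => j' _.
  rewrite (bigD1 (multideg_up p j')) //= big1 ?addr0; last first.
    move=> m' m'p.
    have [i mi] : exists i, mdeg m' i != (mdeg p i + (i == j'))%N.
      apply/existsP; apply: contraNT m'p => /existsPn m'p; apply/eqP.
      by apply: mdeg_inj => i; rewrite mdeg_up; apply/eqP/negPn.
    by rewrite (tens_diff_entry_neq _ mi) mul0rz.
  rewrite koszul_sign_entry ffunE raddf_sum mulrz_suml; apply: eq_bigr => m _.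
  rewrite raddf_sum mulrz_suml; apply: eq_bigr => j _.
  by rewrite koszul_sign_entry raddfMz -mulrzA.
apply: big1 => m _; apply: sum_alternating => [j|j' j jj'].
  rewrite /T [X in X *~ _](_ : _ = 0) ?mul0rz //.
  pose h i : {additive P i (mdeg m i) -> P i (mdeg p i)} :=
    if i == j then (\0 : {additive _ -> _})
    else degid (P i) (mdeg m i) (mdeg p i).
  apply: (etrans (y := tens_map h (x m))); last first.
    by apply: (@tens_map0 _ _ _ _ j) => y; rewrite /h eqxx.
  apply: tens_map_comp => i y; have := mdeg_up p j i; rewrite /h.
  case: eqP => _ mi; first exact: cdiff_cdiff.
  by apply: degid_degid; rewrite mi addn0.
pose h i : {additive P i (mdeg m i) -> P i (mdeg p i)} :=
  if (i == j) || (i == j') then cdiff (P i) (mdeg m i) (mdeg p i)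
  else degid (P i) (mdeg m i) (mdeg p i).
have Th u v :
  (u != v) -> (forall i, (i == u) || (i == v) = (i == j) || (i == j')) ->
  T m u v = tens_map h (x m) *~
    (koszul_sign (multideg_up p u) v * koszul_sign p u).
  move=> uv uvj; rewrite /T; congr (_ *~ _); apply: tens_map_comp => i y.
  have := mdeg_up p u i; rewrite /h -uvj.
  have [iu|iu] := eqVneq i u => /= mi.
    have -> : (i == v) = false by rewrite iu; apply: negPf.
    by apply: cdiff_degid; rewrite mi addn1.
  by case: eqP => _; [apply: degid_cdiff|apply: degid_degid]; rewrite mi addn0.
rewrite (Th j' j) //; last by move=> i; rewrite orbC.
rewrite (Th j j') //; last by rewrite eq_sym.
rewrite -mulrNz; congr (_ *~ _).
have ks u v : koszul_sign (multideg_up p u) v =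
    (-1) ^+ (u < v)%N * koszul_sign p v.
  rewrite /koszul_sign -exprD addnC; congr (_ ^+ _).
  under eq_bigr => i _ do rewrite mdeg_up.
  rewrite big_split /=; congr (_ + _)%N.
  case: (ltnP u v) => uv; first rewrite (bigD1 u) //= eqxx big1 //.
    by move=> i /andP[_ /negPf->].
  rewrite big1 // => i iv; case: eqP iv => // ->.
  by rewrite ltnNge uv.
rewrite !ks -!mulrA (mulrC (koszul_sign p j')) -mulNr; congr (_ * _).
by case: ltngtP jj' => // /val_inj->; rewrite eqxx.
Qed.

Definition tens_complex : chain_complex := ChainComplex tens_diff_diff.

End TensorComplex.

Definition tens2 (X Y : zmodType) : zmodType :=
  tens (fun b : bool => if b then X else Y).

Definition tens2_mapl (X Y M : zmodType) (f : {additive X -> Y}) :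
    {additive tens2 X M -> tens2 Y M} :=
  tens_map (fun b : bool =>
    if b return {additive (if b then X else M) -> (if b then Y else M)}
    then f else idfun).

Definition zflat (M : zmodType) : Prop :=
  forall (X Y : zmodType) (f : {additive X -> Y}),
    injective f -> injective (tens2_mapl M f).

Record flat_resolution (B : zmodType) := FlatResolution {
  resolution :> chain_complex;
  augmentation : {additive resolution 0 -> B};
  resolution_flat : forall k, zflat (resolution k);
  augmentation_surj : forall b, exists x, augmentation x = b;
  resolution_exact0 : forall x,
    augmentation x = 0 <-> exists y, diff resolution 0 y = x;
  resolution_exact : forall k x,
    diff resolution k x = 0 <-> exists y, diff resolution k.+1 y = x
}.

(* Tor is computed from given flat resolutions P j of the groups B j; they may
   be different even if the B j are all equal. *)
Definition Tor n (B : 'I_n -> zmodType) (P : forall j, flat_resolution (B j))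
  (i : nat) : zmodType := homology (tens_complex P) i.

Definition Tor_bracket n (A : zmodType) (P : 'I_n -> flat_resolution A) :
  zmodType := Tor P n.-1.

Definition free_abelian (F : zmodType) : Prop :=
  exists (K : choiceType) (f : {additive {freeg K} -> F}), bijective f.

Record free_ext (A : zmodType) := FreeExt {
  ext_sub : zmodType;
  ext_mid : zmodType;
  ext_incl : {additive ext_sub -> ext_mid};
  ext_proj : {additive ext_mid -> A};
  ext_incl_inj : injective ext_incl;
  ext_proj_surj : forall a, exists x, ext_proj x = a;
  ext_exact : forall x, ext_proj x = 0 <-> exists h, ext_incl h = x;
  ext_mid_free : free_abelian ext_mid
}.

Record ext_hom (A : zmodType) (c c' : free_ext A) := ExtHom {
  hom_sub : {additive ext_sub c -> ext_sub c'};
  hom_mid : {additive ext_mid c -> ext_mid c'};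
  hom_incl : forall h, hom_mid (ext_incl c h) = ext_incl c' (hom_sub h);
  hom_proj : forall x, ext_proj c' (hom_mid x) = ext_proj c x
}.

Definition ext_id (A : zmodType) (c : free_ext A) : ext_hom c c :=
  @ExtHom A c c idfun idfun (fun _ => erefl) (fun _ => erefl).

Lemma ext_comp_incl (A : zmodType) (c1 c2 c3 : free_ext A)
    (v : ext_hom c2 c3) (u : ext_hom c1 c2) h :
  (hom_mid v \o hom_mid u) (ext_incl c1 h) =
  ext_incl c3 ((hom_sub v \o hom_sub u) h).
Proof. by rewrite /= !hom_incl. Qed.

Lemma ext_comp_proj (A : zmodType) (c1 c2 c3 : free_ext A)
    (v : ext_hom c2 c3) (u : ext_hom c1 c2) x :
  ext_proj c3 ((hom_mid v \o hom_mid u) x) = ext_proj c1 x.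
Proof. by rewrite /= !hom_proj. Qed.

Definition ext_comp (A : zmodType) (c1 c2 c3 : free_ext A)
    (v : ext_hom c2 c3) (u : ext_hom c1 c2) : ext_hom c1 c3 :=
  @ExtHom A c1 c3 (hom_sub v \o hom_sub u) (hom_mid v \o hom_mid u)
    (ext_comp_incl v u) (ext_comp_proj v u).

Definition tpow n (B : zmodType) : zmodType := tens (fun _ : 'I_n => B).

Definition tpow_map n (B C : zmodType) (f : {additive B -> C}) :
  {additive tpow n B -> tpow n C} := tens_map (fun _ : 'I_n => f).

Lemma tpow_map_comp n (B C D : zmodType) (g : {additive C -> D})
    (f : {additive B -> C}) (h : {additive B -> D}) :
  (forall x, g (f x) = h x) ->
  forall x, tpow_map n g (tpow_map n f x) = tpow_map n h x.
Proof. by move=> gf; apply: tens_map_comp. Qed.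

Lemma tpow_map_id n (B : zmodType) (x : tpow n B) : tpow_map n idfun x = x.
Proof.
apply: (tens_ext (f := tpow_map n idfun) (g := idfun)) => {}x.
rewrite [LHS]tens_map_pure /=; congr tpure.
by apply/ffunP => i; rewrite ffunE.
Qed.

Section ExtQuotient.
Variables (n : nat) (A : zmodType).

(* H^(x)n as a subgroup of F^(x)n is the image of the map induced by H >-> F. *)
Definition ext_quot (c : free_ext A) : zmodType :=
  {ideal_quot addimage (tpow_map n (ext_incl c))}.

Definition ext_quot_pi (c : free_ext A) :
    {additive tpow n (ext_mid c) -> ext_quot c} :=
  \pi_({ideal_quot addimage (tpow_map n (ext_incl c))}).

Section Map.
Variables (c c' : free_ext A) (u : ext_hom c c').

Definition ext_quot_map_fun (x : ext_quot c) : ext_quot c' :=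
  ext_quot_pi c' (tpow_map n (hom_mid u) (repr x)).

Lemma ext_quot_map_fun_pi x :
  ext_quot_map_fun (ext_quot_pi c x) =
  ext_quot_pi c' (tpow_map n (hom_mid u) x).
Proof.
pose g : {additive tpow n (ext_mid c) -> ext_quot c'} :=
  ext_quot_pi c' \o tpow_map n (hom_mid u).
apply: (factor_pi (g := g)) => {}x /asboolP[h <-].
rewrite -(raddf0 (ext_quot_pi c')); apply/eqP.
rewrite -Quotient.idealrBE subr0; apply/asboolP.
exists (tpow_map n (hom_sub u) h).
pose k : {additive ext_sub c -> ext_mid c'} := hom_mid u \o ext_incl c.
rewrite (@tpow_map_comp _ _ _ _ _ _ k) => [|y]; last by rewrite /= hom_incl.
by rewrite (@tpow_map_comp _ _ _ _ _ _ k).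
Qed.

Lemma ext_quot_map_is_zmod_morphism : zmod_morphism ext_quot_map_fun.
Proof.
move=> x y; rewrite -[x]reprK -[y]reprK -!/(ext_quot_pi c _) -raddfB.
by rewrite !ext_quot_map_fun_pi !raddfB.
Qed.
HB.instance Definition _ := GRing.isZmodMorphism.Build _ _ ext_quot_map_fun
  ext_quot_map_is_zmod_morphism.

Definition ext_quot_map : {additive ext_quot c -> ext_quot c'} :=
  ext_quot_map_fun.

End Map.

Lemma ext_quot_map_id c x : ext_quot_map (ext_id c) x = x.
Proof.
rewrite -[x]reprK -/(ext_quot_pi c _).
by rewrite [LHS]ext_quot_map_fun_pi tpow_map_id.
Qed.

Lemma ext_quot_map_comp c1 c2 c3 (v : ext_hom c2 c3) (u : ext_hom c1 c2) x :
  ext_quot_map (ext_comp v u) x = ext_quot_map v (ext_quot_map u x).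
Proof.
rewrite -[x]reprK -/(ext_quot_pi c1 _) [LHS]ext_quot_map_fun_pi.
rewrite [ext_quot_map u _]ext_quot_map_fun_pi [RHS]ext_quot_map_fun_pi.
by rewrite (@tpow_map_comp _ _ _ _ _ _ (hom_mid (ext_comp v u))).
Qed.

End ExtQuotient.

Section Limit.
Variables (C : Type) (Hom : C -> C -> Type).
Variables (D : C -> zmodType).
Variable (Dmap : forall c c', Hom c c' -> {additive D c -> D c'}).

(* For C := free_ext A this type lives in a larger universe than the carriers
   of zmodType, so that it cannot be given a zmodType structure; its (pointwise)
   addition is inverse_limit_add. *)
Definition inverse_limit : Type :=
  {x : forall c, D c | forall c c' (a : Hom c c'), Dmap a (x c) = x c'}.

Lemma inverse_limit_add_subproof (x y : inverse_limit) c c' (a : Hom c c') :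
  Dmap a (sval x c + sval y c) = sval x c' + sval y c'.
Proof. by rewrite raddfD (svalP x) (svalP y). Qed.

Definition inverse_limit_add (x y : inverse_limit) : inverse_limit :=
  exist _ (fun c => sval x c + sval y c) (@inverse_limit_add_subproof x y).

End Limit.

(* Main.v *)
(** A free extension of A is a flat resolution Q = (H -> F) of A.  Replacing
    one resolution at a time by A itself, in complexes whose other factors are
    flat, shows that Tor may be computed from n copies of Q.  A cycle of degree
    n - 1 of Q^(x)n is then, up to signs, an element of the intersection over a
    of the subgroups H (x) .. (x) F (x) .. (x) H of F^(x)n, with F in position
    a, and it is a boundary if and only if it lies in H^(x)n.  This intersection
    modulo H^(x)n is also the limit: a compatible family takes its values there,
    by comparison of the two inclusions of F in an extension with middle term
    F + F, and any two morphisms of extensions agree there, by telescoping. *)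

From HB Require Import structures.
Require Import Defs.
From mathcomp Require Import all_boot all_order all_algebra.
From mathcomp Require Import boolp freeg.

Set Implicit Arguments.
Unset Strict Implicit.
Unset Printing Implicit Defensive.

Import Order.TTheory GRing.Theory Num.Theory.
Local Open Scope ring_scope.
Local Open Scope quotient_scope.

(** Flatness is defined by tensoring an injection with a single further group, while [tens] is
    formed in one step over a whole index set; splitting off one factor carries flatness over to
    families. The groups H occur only as subgroups of free groups, and torsion-freeness passes to
    subgroups at once, so all flatness of H and F is drawn from the fact that torsion-free groups
    are flat. In degree n - 1 a chain of Q^(x)n has one coordinate for each position a left to F.
    The cycle condition says precisely that the coordinate at a, multiplied by (-1)^a, is the same
    element w of F^(x)n for all a; this is where the intersection comes from. In degree n there is
    one coordinate, with H everywhere, and its boundary is such a constant family. The limit has no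
    [zmodType] structure, so the chain of isomorphisms between groups ends at [lim_val_type], the
    intersection for one extension c. The extension free on the underlying set of A is chosen: it
    maps to every other one, since basis elements may go to arbitrary preimages, so a compatible
    family is determined by its value at c. *)

Definition additive_of (U V : zmodType) (f : U -> V) (fB : zmod_morphism f) :
    {additive U -> V} :=
  HB.pack f (GRing.isZmodMorphism.Build U V f fB).

Lemma additive_inj (U V : zmodType) (f : {additive U -> V}) :
  (forall x, f x = 0 -> x = 0) -> injective f.
Proof.
move=> f0 x y fxy; apply/eqP; rewrite -subr_eq0; apply/eqP/f0.
by rewrite raddfB fxy subrr.
Qed.

Section QuotientBy.
Variables (V : zmodType) (S : zmodClosed V).

Definition quot_pi : {additive V -> {ideal_quot S}} := \pi_({ideal_quot S}).

Lemma quot_pi_eq0 x : quot_pi x = 0 <-> x \in S.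
Proof.
rewrite -(raddf0 quot_pi) -[x in x \in S]subr0 Quotient.idealrBE.
by split=> [/eqP|/eqP].
Qed.

Lemma quot_piP y : exists x, quot_pi x = y.
Proof. by exists (repr y); rewrite /= reprK. Qed.
End QuotientBy.

Section TensorLift.
Variables (I : finType) (B : I -> zmodType) (V : zmodType).

Definition multiadditive (g : {dffun forall i, B i} -> V) :=
  forall i (x y z : {dffun forall i, B i}),
  x i = y i + z i -> (forall j, j != i -> x j = y j) ->
  (forall j, j != i -> x j = z j) -> g x = g y + g z.

Lemma tens_lift g : multiadditive g ->
  exists f : {additive tens B -> V}, forall x, f (tpure x) = g x.
Proof.
move=> gD; have gB : zmod_morphism (tlift g).
  move=> x y; rewrite -[x]reprK -[y]reprK -!/(tpi _) -raddfB.
  by rewrite !tlift_pi // raddfB.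
by exists (additive_of gB) => x; rewrite /= tlift_pi // fgliftzU.
Qed.
End TensorLift.

Lemma tens_gen (I : finType) (B : I -> zmodType) (S : zmodClosed (tens B)) :
  (forall x, tpure x \in S) -> forall x, x \in S.
Proof.
move=> Sx x; apply/quot_pi_eq0.
by apply: (tens_ext (f := quot_pi S) (g := \0)) => y; apply/quot_pi_eq0.
Qed.

Lemma tens_map_ext (I : finType) (B C : I -> zmodType)
    (f g : forall i, {additive B i -> C i}) :
  (forall i, f i =1 g i) -> tens_map f =1 tens_map g.
Proof.
move=> fg; apply: tens_ext => x; rewrite /= !tens_map_pure; congr tpure.
by apply/ffunP => i; rewrite !ffunE fg.
Qed.

Lemma tens_map_id (I : finType) (B : I -> zmodType)
    (f : forall i, {additive B i -> B i}) :
  (forall i x, f i x = x) -> forall x, tens_map f x = x.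
Proof.
move=> fE; apply: (tens_ext (g := idfun)) => x; rewrite /= tens_map_pure.
by congr tpure; apply/ffunP => i; rewrite ffunE fE.
Qed.

Lemma tens_mapK (I : finType) (B C : I -> zmodType)
    (f : forall i, {additive B i -> C i}) (g : forall i, {additive C i -> B i}) :
  (forall i, cancel (f i) (g i)) -> cancel (tens_map f) (tens_map g).
Proof.
move=> fK x; rewrite (@tens_map_comp _ _ _ _ _ _ (fun=> idfun)) //.
exact: tens_map_id.
Qed.

Lemma tens_map_surj (I : finType) (B C : I -> zmodType)
    (f : forall i, {additive B i -> C i}) :
  (forall i y, exists x, f i x = y) -> forall y, exists x, tens_map f x = y.
Proof.
move=> fs y; apply/asboolP; move: y.
apply: (@tens_gen _ _ (addimage (tens_map f))) => y; apply/asboolP.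
have [x xP] := fin_all_exists (fun i => fs i (y i)).
exists (tpure ([ffun i => x i] : {dffun forall i, B i})).
rewrite /= tens_map_pure; congr tpure.
by apply/ffunP => i; rewrite !ffunE xP.
Qed.

(** * Torsion-free groups are flat *)

Definition torsion_free (M : zmodType) : Prop :=
  forall (x : M) k, x *+ k.+1 = 0 -> x = 0.

Lemma torsion_free_mulz (M : zmodType) (x : M) (d : int) :
  torsion_free M -> d != 0 -> x *~ d = 0 -> x = 0.
Proof.
move=> Mtf; case: d => [[|k]|k] //= _ xk; first exact: Mtf xk.
by apply: (Mtf _ k); apply/eqP; rewrite -oppr_eq0; apply/eqP.
Qed.

Section ElementaryTensors.
Variables X M : zmodType.

Definition fam2 (b : bool) : zmodType := if b then X else M.
Definition pair2 (x : X) (m : M) : {dffun forall b, fam2 b} :=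
  [ffun b => if b return fam2 b then x else m].
Definition tensor2 x m : tens2 X M := tpure (pair2 x m).

Lemma pair2_eta (z : {dffun forall b, fam2 b}) : pair2 (z true) (z false) = z.
Proof. by apply/ffunP => -[]; rewrite ffunE. Qed.

Lemma tens2_lift (V : zmodType) (b : X -> M -> V) :
  (forall x x' m, b (x + x') m = b x m + b x' m) ->
  (forall x m m', b x (m + m') = b x m + b x m') ->
  exists f : {additive tens2 X M -> V}, forall x m, f (tensor2 x m) = b x m.
Proof.
move=> bDl bDr.
have [|f fE] := @tens_lift _ _ V
  (fun z : {dffun forall b, fam2 b} => b (z true) (z false)).
  move=> [] x y z /= -> xy xz.
    by rewrite bDl -(xy false) // -(xz false).
  by rewrite bDr -(xy true) // -(xz true).
by exists f => x m; rewrite fE !ffunE.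
Qed.
End ElementaryTensors.

(* b need only be additive on S in its first argument; it extends
   (x, m) |-> x (x) m up to an embedding of X (x) M. *)
Definition balanced_ext (X Y M : zmodType) (f : {additive X -> Y})
    (S : Y -> Prop) :=
  exists (V : zmodType) (iota : {additive tens2 X M -> V})
    (b : Y -> {additive M -> V}),
  [/\ injective iota, forall x m, b (f x) m = iota (tensor2 x m) &
      forall u v m, S u -> S v -> b (u - v) m = b u m - b v m].

Lemma int_subgroup_gen (S : int -> Prop) :
  S 0 -> (forall a b, S a -> S b -> S (a - b)) ->
  exists2 d, S d & forall k, S k -> exists q, k = q * d.
Proof.
move=> S0 SB.
have SN a : S a -> S (- a) by move=> Sa; rewrite -sub0r; apply: SB.
have SD a b : S a -> S b -> S (a + b).
  by move=> Sa /SN Sb; rewrite -[b]opprK; apply: SB.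
have SM a (n : nat) : S a -> S (a *+ n).
  by move=> Sa; elim: n => // n IH; rewrite mulrS; apply: SD.
have SMz a q : S a -> S (q * a).
  move=> Sa; rewrite mulrC; case: (intP q) => [|n|n]; first by rewrite mulr0.
    by rewrite -natz mulr_natr; apply: SM.
  by rewrite -natz mulrN mulr_natr; apply/SN/SM.
case: (pselect (exists n, `[< S n.+1%:Z >])) => [nS|noS].
  exists (ex_minn nS).+1%:Z.
    by case: ex_minnP => m /asboolP.
  case: ex_minnP => m /asboolP Sm mmin k Sk; exists (k %/ m.+1)%Z.
  rewrite {1}(divz_eq k m.+1); apply/eqP; rewrite -subr_eq0 addrAC subrr add0r.
  have: S (k %% m.+1)%Z by apply/SB/SMz.
  have: (k %% m.+1 < m.+1)%Z by apply: ltz_pmod.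
  have: (0 <= k %% m.+1)%Z by apply: modz_ge0.
  case: (k %% m.+1)%Z => // -[//|r] _ rm Sr.
  have := mmin r (asboolT Sr).
  by rewrite leqNgt -ltnS -ltz_nat rm.
exists 0 => // k Sk; exists 0; rewrite mulr0.
case: (intP k) Sk => // n Sn; case: noS; exists n; apply/asboolP => //.
by move/SN: Sn; rewrite opprK.
Qed.

(** A pushout adjoins y to S. If d generates the integers k with y *~ k in S, then W is V * M modulo
    the pairs (b (y *~ d) m, - d m), so that the second component records y (x) m. The map V -> W
    stays injective on the image of [iota]: a relation with zero second component has d m = 0, hence
    m = 0 by torsion-freeness unless d = 0, and in both cases its first component vanishes. *)
Lemma balanced_ext_step (X Y M : zmodType) (f : {additive X -> Y})
    (S : Y -> Prop) (y : Y) : torsion_free M ->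
  (forall x, S (f x)) -> (forall u v, S u -> S v -> S (u - v)) ->
  balanced_ext M f S ->
  balanced_ext M f (fun v => exists u k, S u /\ v = u + y *~ k).
Proof.
move=> Mtf Sf SB [V [iota [b [iota_inj bf bB]]]].
have S0 : S 0 by rewrite -(raddf0 f).
have b0 m : b 0 m = 0 by rewrite -(subr0 0) bB // subrr.
have SN u : S u -> S (- u) by move=> Su; rewrite -sub0r; apply: SB.
have bN u m : S u -> b (- u) m = - b u m.
  by move=> Su; rewrite -sub0r bB // b0 sub0r.
have SMn u n : S u -> S (u *+ n).
  move=> Su; elim: n => // n IH; rewrite mulrSr -[u in _ + u]opprK.
  exact/SB/SN.
have bMn u n m : S u -> b (u *+ n) m = b u m *+ n.
  move=> Su; elim: n => [|n IH]; first by rewrite b0.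
  have -> : u *+ n.+1 = u *+ n - - u by rewrite opprK mulrSr.
  by rewrite bB ?bN ?opprK ?IH -?mulrSr //; [apply: SMn|apply: SN].
have bMz u (q : int) m : S u -> b (u *~ q) m = b u m *~ q.
  move=> Su; case: q => n; first by rewrite -!pmulrn bMn.
  by rewrite NegzE !mulrNz -!pmulrn bN ?bMn //; apply: SMn.
have [||d Sd dgen] := @int_subgroup_gen (fun k => S (y *~ k)).
- by [].
- by move=> p q Sp Sq; rewrite mulrzBr; apply: SB.
have rB : zmod_morphism (fun m : M => (b (y *~ d) m, m *~ (- d)) : V * M).
  by move=> m m'; rewrite raddfB mulrzBl.
pose r := additive_of rB.
pose W : zmodType := {ideal_quot addimage r}.
(* A decomposition is fixed for each v in the enlarged subgroup, with junk value (0, 0) outside;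
   [eE] shows that the class in W does not depend on it. *)
have dec v : exists p : Y * int, (exists u k, S u /\ v = u + y *~ k) ->
    S p.1 /\ v = p.1 + y *~ p.2.
  case: (pselect (exists u k, S u /\ v = u + y *~ k)) => [[u [k uk]]|nv].
    by exists (u, k).
  by exists (0, 0).
have [c cP] := choice dec.
have eB u k : zmod_morphism (fun m : M => (b u m, m *~ k) : V * M).
  by move=> m m'; rewrite raddfB mulrzBl.
pose e u k : {additive M -> W} := quot_pi (addimage r) \o additive_of (eB u k).
have eE u u' k k' m : S u -> S u' -> u + y *~ k = u' + y *~ k' ->
    e u k m = e u' k' m.
  move=> Su Su' uk; apply/eqP; rewrite -subr_eq0 -[e u k m]/(quot_pi _ (_, _)).
  rewrite -[e u' k' m]/(quot_pi _ (_, _)) -raddfB; apply/eqP/quot_pi_eq0.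
  have uu : u - u' = y *~ (k' - k).
    apply/eqP; rewrite subr_eq addrC mulrzBr addrA eq_sym subr_eq addrC uk.
    by rewrite addrC.
  have [|q qE] := dgen (k' - k); first by rewrite -uu; apply: SB.
  apply/asboolP; exists (m *~ q).
  rewrite -[LHS]/(b (y *~ d) (m *~ q), m *~ q *~ (- d)).
  rewrite -[RHS]/(b u m - b u' m, m *~ k - m *~ k') -bB // uu qE.
  congr (_, _); first by rewrite raddfMz mulrC mulrzA (bMz (y *~ d)).
  by rewrite -mulrzA mulrN -qE opprB mulrzBr.
have iB : zmod_morphism (fun t : tens2 X M => quot_pi (addimage r) (iota t, 0)).
  move=> t t'; rewrite -raddfB; congr (quot_pi _ _).
  by rewrite raddfB -[RHS]/(_ - _, 0 - 0) subr0.
exists W, (additive_of iB), (fun v => e (c v).1 (c v).2); split.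
- apply: additive_inj => t /= /quot_pi_eq0 /asboolP[m [tm /eqP]].
  rewrite mulrNz oppr_eq0 => /eqP md; apply: iota_inj; rewrite raddf0 -tm.
  have [d0|d0] := eqVneq d 0; first by rewrite d0 b0.
  by rewrite (torsion_free_mulz Mtf d0 md) raddf0.
- move=> x m /=; have [|Sc fE] := cP (f x).
    by exists (f x), 0; rewrite addr0.
  rewrite -[LHS]/(e (c (f x)).1 (c (f x)).2 m) (@eE _ (f x) _ 0) // -?fE ?addr0 //.
  by rewrite /= bf.
- move=> u v m Su Sv; have [Su1 uE] := cP u Su; have [Sv1 vE] := cP v Sv.
  have [|Suv uvE] := cP (u - v).
    exists ((c u).1 - (c v).1), ((c u).2 - (c v).2); split; first exact: SB.
    by rewrite mulrzBr addrACA -opprD -uE -vE.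
  rewrite (@eE _ ((c u).1 - (c v).1) _ ((c u).2 - (c v).2)) //; first last.
  + by rewrite -uvE mulrzBr addrACA -opprD -uE -vE.
  + exact: SB.
  apply: (etrans _ (raddfB (quot_pi _) (b (c u).1 m, m *~ (c u).2)
    (b (c v).1 m, m *~ (c v).2))).
  by rewrite -[RHS]/(quot_pi _ (_ - _, _ - _)) /e /= bB // mulrzBr.
Qed.

Lemma tensor2D_l (X M : zmodType) (x x' : X) (m : M) :
  tensor2 (x + x') m = tensor2 x m + tensor2 x' m.
Proof. by apply: (@tpure_add _ _ true) => [|[]|[]]; rewrite !ffunE. Qed.

Lemma tensor2D_r (X M : zmodType) (x : X) (m m' : M) :
  tensor2 x (m + m') = tensor2 x m + tensor2 x m'.
Proof. by apply: (@tpure_add _ _ false) => [|[]|[]]; rewrite !ffunE. Qed.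

Lemma tensor2B_l (X M : zmodType) (x x' : X) (m : M) :
  tensor2 (x - x') m = tensor2 x m - tensor2 x' m.
Proof. by apply/eqP; rewrite eq_sym subr_eq -tensor2D_l subrK. Qed.

Lemma tensor2B_r (X M : zmodType) (x : X) (m m' : M) :
  tensor2 x (m - m') = tensor2 x m - tensor2 x m'.
Proof. by apply/eqP; rewrite eq_sym subr_eq -tensor2D_r subrK. Qed.

Lemma tens2_mapl_tensor (X Y M : zmodType) (f : {additive X -> Y}) x (m : M) :
  tens2_mapl M f (tensor2 x m) = tensor2 (f x) m.
Proof.
by rewrite /= tens_map_pure; congr tpure; apply/ffunP => -[]; rewrite !ffunE.
Qed.

Lemma balanced_ext_range (X Y M : zmodType) (f : {additive X -> Y}) :
  injective f -> balanced_ext M f (fun v => exists x, f x = v).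
Proof.
move=> finj; have xP v : exists x, (exists x', f x' = v) -> f x = v.
  case: (pselect (exists x', f x' = v)) => [[x' xE]|nv]; first by exists x'.
  by exists 0.
have {xP} [g gP] := choice xP.
have gf x : g (f x) = x by apply/finj/gP; exists x.
have tB v : zmod_morphism (tensor2 (g v) : M -> _).
  by move=> m m'; apply: tensor2B_r.
exists (tens2 X M), idfun, (fun v => additive_of (tB v)); split=> //.
  by move=> x m /=; rewrite gf.
by move=> _ _ m [x <-] [x' <-] /=; rewrite -raddfB !gf tensor2B_l.
Qed.

Lemma balanced_ext_seq (X Y M : zmodType) (f : {additive X -> Y}) (s : seq Y) :
  torsion_free M -> injective f ->
  exists S : Y -> Prop, [/\ {in s, forall y, S y}, forall x, S (f x),
    forall u v, S u -> S v -> S (u - v) & balanced_ext M f S].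
Proof.
move=> Mtf finj; elim: s => [|y s [S [Ss Sf SB SM]]].
  exists (fun v => exists x, f x = v); split=> //; first by move=> x; exists x.
    by move=> _ _ [x <-] [x' <-]; exists (x - x'); rewrite raddfB.
  exact: balanced_ext_range.
exists (fun v => exists u k, S u /\ v = u + y *~ k); split.
- move=> v; rewrite inE => /orP[/eqP->|/Ss Sv].
    by exists 0, 1; rewrite add0r -(raddf0 f).
  by exists v, 0; rewrite addr0.
- by move=> x; exists (f x), 0; rewrite addr0.
- move=> _ _ [u [k [Su ->]]] [v [l [Sv ->]]]; exists (u - v), (k - l).
  by split; [apply: SB|rewrite mulrzBr addrACA opprD].
- exact: balanced_ext_step.
Qed.

(** If z dies in Y (x) M, finitely many relations witness this, and they involve finitely many
    elements of Y. Adjoining these to the range of f one at a time gives a map b that is biadditive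
    wherever the relations need it; it sends the image of z both to 0 and to [iota] z. *)
Lemma torsion_free_flat (M : zmodType) : torsion_free M -> zflat M.
Proof.
move=> Mtf X Y f finj; apply: additive_inj => z.
rewrite -[z]reprK -/(tpi _); set w := repr z.
pose fs : {additive {freeg {dffun forall b, fam2 X M b}} ->
    {freeg {dffun forall b, fam2 Y M b}}} :=
  fgliftz (fun p => << pair2 (f (p true)) (p false) >>).
have piE : tens2_mapl M f (tpi w) = tpi (fs w).
  rewrite -[w]freeg_sumE !raddf_sum; apply: eq_bigr => p _.
  rewrite -[coeff p _]intz -freegU_mulz !raddfMz; congr (_ *~ _).
  rewrite -/(tpure p) -[fs _]/(fgliftz _ _) fgliftzU.
  by rewrite -{1}(pair2_eta p) [LHS]tens2_mapl_tensor.
rewrite {}piE -(raddf0 (@tpi _ _)) => /eqP; rewrite -Quotient.idealrBE subr0.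
move=> /asboolP.
(* The list collects the first coordinates occurring in a derivation of v from the relations; b
   kills v as soon as it is biadditive on a subgroup containing them. *)
have finite v : spanned (@tens_rel _ (fam2 Y M)) v -> exists s : seq Y,
    forall (V : zmodType) (b : Y -> {additive M -> V}) (S : Y -> Prop),
    {in s, forall y, S y} -> (forall u v, S u -> S v -> S (u - v)) ->
    (forall u v m, S u -> S v -> b (u - v) m = b u m - b v m) ->
    fgliftz (fun p : {dffun forall b, fam2 Y M b} => b (p true) (p false)) v = 0.
  elim=> [_ [i x y u xi xy xu]||v1 v2 _ [s1 v10] _ [s2 v20]].
  - exists [:: x true; y true; u true] => V b S Ss SB bB.
    have [Sx Sy Su] : [/\ S (x true), S (y true) & S (u true)].
      by split; apply: Ss; rewrite !inE eqxx ?orbT.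
    rewrite !raddfB /= !fgliftzU.
    case: i xi xy xu => /= xi xy xu.
      rewrite -(xy false) // -(xu false) // xi in Sx *.
      have yE : y true = y true + u true - u true by rewrite addrK.
      by rewrite [in b (y true)]yE bB // opprB addrA addrAC subrr add0r subrr.
    rewrite -(xy true) // -(xu true) //.
    by rewrite xi raddfD (addrC (b _ _)) addrK subrr.
  - by exists [::] => *; rewrite raddf0.
  - exists (s1 ++ s2) => V b S Ss SB bB; rewrite raddfB /=.
    rewrite (v10 V b S) ?(v20 V b S) ?subr0 // => y ys; apply: Ss.
      by rewrite mem_cat ys orbT.
    by rewrite mem_cat ys.
move=> /finite[s sP].
have [S [Ss Sf SB [V [iota [b [iinj bf bB]]]]]] := balanced_ext_seq s Mtf finj.
have := sP V b S Ss SB bB; set g := (fun p => _) => gw.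
apply: iinj; rewrite raddf0 -gw.
rewrite -[w]freeg_sumE !raddf_sum; apply: eq_bigr => p _.
rewrite -[coeff p _]intz -freegU_mulz !raddfMz; congr (_ *~ _).
rewrite -[fs _]/(fgliftz _ _) fgliftzU /= fgliftzU /g.
by rewrite -/(tpure p) -{1}(pair2_eta p) -bf !ffunE.
Qed.

(** * Exactness of n-fold tensor products in one factor *)

Lemma zflat_retract (M N : zmodType) (s : {additive M -> N})
    (r : {additive N -> M}) : cancel s r -> zflat N -> zflat M.
Proof.
move=> sK Nflat X Y f finj.
have [|x m m'|sX sXE] := @tens2_lift X M (tens2 X N) (fun x m => tensor2 x (s m)).
- by move=> x x' m; rewrite tensor2D_l.
- by rewrite raddfD tensor2D_r.
have [|x m m'|rX rXE] := @tens2_lift X N (tens2 X M) (fun x m => tensor2 x (r m)).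
- by move=> x x' m; rewrite tensor2D_l.
- by rewrite raddfD tensor2D_r.
have [|x m m'|sY sYE] := @tens2_lift Y M (tens2 Y N) (fun x m => tensor2 x (s m)).
- by move=> x x' m; rewrite tensor2D_l.
- by rewrite raddfD tensor2D_r.
have sXK : cancel sX rX.
  apply: (tens_ext (f := rX \o sX) (g := idfun)) => p.
  by rewrite -(pair2_eta p) /= -/(tensor2 _ _) sXE rXE sK.
have sf z : tens2_mapl N f (sX z) = sY (tens2_mapl M f z).
  move: z; apply: (tens_ext (f := tens2_mapl N f \o sX)
    (g := sY \o tens2_mapl M f)) => p.
  rewrite -(pair2_eta p) -/(tensor2 _ _) [LHS]/= [RHS]/=.
  by rewrite sXE !tens2_mapl_tensor sYE.
move=> z z' zz'; apply: (can_inj sXK); apply: (Nflat _ _ f finj).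
by rewrite !sf zz'.
Qed.

Section Singleton.
Variables (I : finType) (j : I) (B : I -> zmodType).
Hypothesis all_j : forall i : I, i = j.

Lemma tens_singleton : exists e : {additive tens B -> B j},
  injective e /\ forall x, e (tpure x) = x j.
Proof.
have [|e eE] := @tens_lift _ B (B j) (fun x => x j).
  by move=> i x y z; rewrite (all_j i).
pose sfun (y : B j) : {dffun forall i, B i} :=
  [ffun i => dfwith (fun k => 0 : B k) y i].
have sB : zmod_morphism (fun y => tpure (sfun y)).
  move=> y y'; apply/eqP; rewrite eq_sym subr_eq; apply/eqP.
  apply: (@tpure_add _ _ j) => [|i|i]; try by rewrite (all_j i) eqxx.
  by rewrite !ffunE !dfwith_in subrK.
exists e; split=> // x x' xx'.
have eK : cancel e (additive_of sB).
  apply: (tens_ext (f := additive_of sB \o e) (g := idfun)) => z /=.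
  rewrite eE; congr tpure; apply/ffunP => i; rewrite ffunE (all_j i).
  exact: dfwith_in.
exact: (can_inj eK).
Qed.
End Singleton.

Section SplitOff.
Variables (I : finType) (i0 : I).
Let J := {i | i != i0}.

Section Glue.
Variable B : I -> zmodType.

(** [pselect] supplies the proof that an index of the subtype requires. The value 0 arises only at
    i0, where [dfwith] overwrites it. *)
Definition glue (x : {dffun forall j : J, B (val j)}) (m : B i0) :
    {dffun forall i, B i} :=
  [ffun i => dfwith (fun i => match pselect (i != i0) return B i with
                              | left p => x (exist _ i p)
                              | _ => 0 : B i end) m i].

Lemma glue_in x m : glue x m i0 = m.
Proof. by rewrite ffunE dfwith_in. Qed.

Lemma glue_out x m j : glue x m (val j) = x j.
Proof.
rewrite ffunE dfwith_out; last by rewrite eq_sym; apply: (valP j).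
case: j => i p /=; case: pselect => // p'.
by rewrite (bool_irrelevance p p').
Qed.

Definition restr (x : {dffun forall i, B i}) : {dffun forall j : J, B (val j)} :=
  [ffun j => x (val j)].

Lemma glue_restr x : glue (restr x) (x i0) = x.
Proof.
apply/ffunP => i; have [->|ii0] := eqVneq i i0; first exact: glue_in.
by rewrite (glue_out _ _ (exist _ i ii0)) ffunE.
Qed.

(** The bridge from the two-factor notion [zflat] to families. Inserting m back by [glue] is
    additive in both arguments and yields a left inverse. *)
Lemma tens_split_off : exists phi :
    {additive tens B -> tens2 (tens (fun j : J => B (val j))) (B i0)},
  injective phi /\ forall x, phi (tpure x) = tensor2 (tpure (restr x)) (x i0).
Proof.
have [|phi phiE] := @tens_lift _ B _ (fun x => tensor2 (tpure (restr x)) (x i0)).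
  move=> i x y z xi xy xz; have [ii0|ii0] := eqVneq i i0.
    move: xi xy xz; rewrite ii0 => -> xy xz; rewrite tensor2D_r.
    congr (tensor2 (tpure _) _ + tensor2 (tpure _) _); apply/ffunP => -[k p].
      by rewrite !ffunE xy.
    by rewrite !ffunE xz.
  rewrite -(xy i0) 1?eq_sym // -(xz i0) 1?eq_sym // -tensor2D_l.
  congr (tensor2 _ _); apply: (@tpure_add _ _ (exist _ i ii0)) => [|k kj|k kj].
  - by rewrite !ffunE.
  - by rewrite !ffunE xy.
  - by rewrite !ffunE xz.
exists phi; split=> //.
have exg m : exists g : {additive tens (fun j : J => B (val j)) -> tens B},
    forall x, g (tpure x) = tpure (glue x m).
  apply: tens_lift => k x y z xk xy xz.
  apply: (@tpure_add _ _ (val k)) => [|i ik|i ik]; first by rewrite !glue_out.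
    have [->|ii0] := eqVneq i i0; first by rewrite !glue_in.
    by rewrite !(glue_out _ _ (exist _ i ii0)) xy.
  have [->|ii0] := eqVneq i i0; first by rewrite !glue_in.
  by rewrite !(glue_out _ _ (exist _ i ii0)) xz.
have [g gE] := choice exg.
have [x x' m|x m m'|psi psiE] :=
  @tens2_lift (tens (fun j : J => B (val j))) (B i0) _ (fun t m => g m t).
- exact: raddfD.
- move: x; apply: (tens_ext (f := g (m + m')) (g := g m \+ g m')) => x /=.
  rewrite !gE; apply: (@tpure_add _ _ i0) => [|i ii0|i ii0].
  + by rewrite !glue_in.
  + by rewrite !(glue_out _ _ (exist _ i ii0)).
  + by rewrite !(glue_out _ _ (exist _ i ii0)).
have phiK : cancel phi psi.
  apply: (tens_ext (f := psi \o phi) (g := idfun)) => x /=.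
  by rewrite phiE psiE gE glue_restr.
exact: can_inj phiK.
Qed.
End Glue.
End SplitOff.

(** Induction on the number of factors. A factor i0 other than j is split off and its map undone by
    the retraction g; what remains is the map on the other factors, injective by induction, tensored
    with the flat group B i0. *)
Lemma tens_map_inj (I : finType) (j : I) (B C : I -> zmodType)
    (f : forall i, {additive B i -> C i}) :
  injective (f j) ->
  (forall i, i != j -> zflat (B i) /\
     exists g : {additive C i -> B i}, cancel (f i) g) ->
  injective (tens_map f).
Proof.
move: {2}#|I| (erefl #|I|) => n nI.
elim: n I nI j B C f => [|n IHn] I nI j B C f fj fi.
  by have := fintype0 j nI.
apply: additive_inj => x.
case: (pickP (fun i => i != j)) => [i0 i0j|all_j]; last first.
  have {}all_j i : i = j by apply/eqP/negPn; rewrite all_j.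
  have [e [e_inj eE]] := tens_singleton B all_j.
  have [e' [_ e'E]] := tens_singleton C all_j.
  have e'f : e' (tens_map f x) = f j (e x).
    move: x; apply: (tens_ext (f := e' \o tens_map f) (g := f j \o e)) => x /=.
    by rewrite tens_map_pure e'E eE ffunE.
  move=> fx; apply: e_inj; apply: fj.
  by rewrite -e'f /= fx !raddf0.
pose J := {i | i != i0}; pose fJ (k : J) := f (val k).
have [phi [phi_inj phiE]] := tens_split_off i0 B.
have [phi' [_ phi'E]] := tens_split_off i0 C.
have [Bi0 [g gK]] := fi _ i0j.
have ji0 : j != i0 by rewrite eq_sym.
have fJ_inj : injective (tens_map fJ).
  apply: (IHn J _ (exist _ j ji0)) => [|//|[k ki0] kj]; last exact: fi.
  by rewrite card_sig cardC1 nI.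
have [t t' m|t m m'|h hE] := @tens2_lift (tens (fun k : J => C (val k))) (C i0)
  (tens2 (tens (fun k : J => C (val k))) (B i0)) (fun t m => tensor2 t (g m)).
- by rewrite tensor2D_l.
- by rewrite raddfD tensor2D_r.
have hphi : h (phi' (tens_map f x)) = tens2_mapl _ (tens_map fJ) (phi x).
  move: x; apply: (tens_ext (f := h \o (phi' \o tens_map f))
    (g := tens2_mapl _ (tens_map fJ) \o phi)) => x.
  rewrite [LHS]/= [RHS]/= tens_map_pure phi'E hE phiE.
  rewrite [RHS]tens2_mapl_tensor !ffunE gK; congr (tensor2 _ _).
  by rewrite /= tens_map_pure; congr tpure; apply/ffunP => k; rewrite !ffunE.
move=> fx; apply: phi_inj; apply: (Bi0 _ _ _ fJ_inj).
by rewrite /= -hphi fx !raddf0.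
Qed.

Lemma quot_lift (V W : zmodType) (S : zmodClosed V) (g : {additive V -> W}) :
  (forall x, x \in S -> g x = 0) ->
  exists h : {additive {ideal_quot S} -> W}, forall x, h (quot_pi S x) = g x.
Proof.
move=> gS; have hB : zmod_morphism (fun y : {ideal_quot S} => g (repr y)).
  move=> y z; have [x <-] := quot_piP y; have [x' <-] := quot_piP z.
  by rewrite -raddfB !(factor_pi gS) raddfB.
by exists (additive_of hB) => x; apply: factor_pi.
Qed.

Lemma quot_kernel_inj (V W : zmodType) (g : {additive V -> W}) :
  exists h : {additive {ideal_quot addkernel g} -> W},
  injective h /\ forall x, h (quot_pi (addkernel g) x) = g x.
Proof.
have [x /eqP//|h hE] := @quot_lift _ _ (addkernel g) g.
exists h; split=> //; apply: additive_inj => y.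
have [x <-] := quot_piP y; rewrite hE => gx.
by apply/quot_pi_eq0/eqP.
Qed.

Lemma dffun_update (I : finType) (B : I -> zmodType) j
    (x : {dffun forall i, B i}) (v : B j) :
  exists y : {dffun forall i, B i}, y j = v /\ forall i, i != j -> y i = x i.
Proof.
exists [ffun i => dfwith (fun k => x k : B k) v i]; split.
  by rewrite ffunE dfwith_in.
by move=> i ij; rewrite ffunE dfwith_out // eq_sym.
Qed.

(** Each g i factors as the quotient map p i onto C i / ker (g i) followed by an injection h i.
    [tens_map_inj] makes the tensor product of the h i injective, so y already dies under the p i.
    Right exactness then follows by inverting the map induced by the p i modulo the image of f. *)
Lemma tens_exact (I : finType) (j : I) (B C D : I -> zmodType)
    (f : forall i, {additive B i -> C i}) (g : forall i, {additive C i -> D i}) :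
  (forall y, g j y = 0 -> exists x, f j x = y) ->
  (forall i, i != j -> [/\ zflat (C i), forall y, exists x, f i x = y &
     exists h : {additive D i -> C i}, cancel (g i) h]) ->
  forall y, tens_map g y = 0 -> exists x, tens_map f x = y.
Proof.
move=> fg_exact fg y gy.
pose E i : zmodType := {ideal_quot addkernel (g i)}.
pose p i : {additive C i -> E i} := quot_pi (addkernel (g i)).
have [h hP] := fin_all_exists (fun i => quot_kernel_inj (g i)).
have h_inj i := (hP i).1; have hp i := (hP i).2.
have g0 i (z : C i) : i != j -> g i z = 0 -> z = 0.
  by move=> /fg[_ _ [k kK]] gz; rewrite -(kK z) gz raddf0.
have hinj : injective (tens_map h).
  apply: (tens_map_inj (j := j)) => // i ij.
  have [Cflat _ [k kK]] := fg i ij.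
  have hkp : cancel (h i) (p i \o k).
    by move=> z; have [x <-] := quot_piP z; rewrite hp /= kK.
  split; last by exists (p i \o k).
  apply: (zflat_retract (s := k \o h i) (r := p i)) Cflat => z.
  exact: hkp.
have {gy}py : tens_map p y = 0.
  apply: hinj; rewrite raddf0 -gy; apply: tens_map_comp => i x.
  exact: hp.
pose Im := addimage (tens_map f).
have pure_im (c : {dffun forall i, C i}) : g j (c j) = 0 -> tpure c \in Im.
  move=> /fg_exact[b bE]; apply/asboolP.
  have fc i : exists x, f i x = c i.
    have [->|ij] := eqVneq i j; first by exists b.
    by have [_ /(_ (c i)) fs _] := fg i ij.
  have [x xP] := fin_all_exists fc.
  exists (tpure ([ffun i => x i] : {dffun forall i, B i})).
  rewrite /= tens_map_pure; congr tpure.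
  by apply/ffunP => i; rewrite !ffunE xP.
(* Off j the entries agree because g i is injective there; at j they differ by an element of ker (g
   j), so the two pure tensors differ by one lying in [Im]. *)
have pure_eq (c c' : {dffun forall i, C i}) :
    (forall i, g i (c i) = g i (c' i)) ->
    quot_pi Im (tpure c) = quot_pi Im (tpure c').
  move=> cc'; apply/eqP; rewrite -subr_eq0 -raddfB; apply/eqP/quot_pi_eq0.
  have [d [dj di]] := dffun_update c (c j - c' j).
  have c'E i : i != j -> c i = c' i.
    move=> ij; apply/eqP; rewrite -subr_eq0; apply/eqP/(g0 _ _ ij).
    by rewrite raddfB cc' subrr.
  rewrite (@tpure_add _ _ j c d c') => [|||i ij]; last exact: c'E.
  - by rewrite addrK; apply: pure_im; rewrite dj raddfB cc' subrr.
  - by rewrite dj subrK.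
  - by move=> i /di.
pose rp (e : {dffun forall i, E i}) : {dffun forall i, C i} :=
  [ffun i => repr (e i)].
have g_rp e i : g i (rp e i) = h i (e i).
  by rewrite ffunE -hp /p; congr (h i _); rewrite /= reprK.
(* Representatives are not additive, but by [pure_eq] the class modulo [Im] sees only their images
   under g, which are. *)
have [|s sE] := @tens_lift _ E _ (fun e => quot_pi Im (tpure (rp e))).
  move=> i e e1 e2 ei ee1 ee2.
  have [c [ci ck]] := dffun_update (rp e) (rp e1 i + rp e2 i).
  rewrite (pure_eq _ c) => [|k]; last first.
    have [->|ki] := eqVneq k i; last by rewrite ck.
    by rewrite ci raddfD !g_rp ei raddfD.
  rewrite -raddfD; congr (quot_pi _ _); apply: (tpure_add ci) => k ki.
    by rewrite ck // !ffunE ee1.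
  by rewrite ck // !ffunE ee2.
have sp : s (tens_map p y) = quot_pi Im y.
  move: y {py}; apply: (tens_ext (f := s \o tens_map p) (g := quot_pi Im)) => c.
  rewrite [LHS]/= tens_map_pure sE; apply: pure_eq => i.
  by rewrite g_rp ffunE hp.
suff /asboolP: y \in Im by [].
by apply/quot_pi_eq0; rewrite -sp py raddf0.
Qed.

(** * Homology of tensor products of complexes *)

Lemma inj_surj_bij (U V : Type) (f : U -> V) :
  injective f -> (forall y, exists x, f x = y) -> bijective f.
Proof.
move=> finj /choice[g gK]; exists g => // x.
by apply: finj; rewrite gK.
Qed.

Definition zmod_iso (U V : zmodType) : Prop :=
  exists f : {additive U -> V}, bijective f.

Lemma zmod_iso_refl U : zmod_iso U U.
Proof. by exists idfun; exists id. Qed.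

Lemma zmod_iso_sym U V : zmod_iso U V -> zmod_iso V U.
Proof.
move=> [f [g fK gK]]; have gB : zmod_morphism g.
  by move=> x y; apply: (can_inj fK); rewrite raddfB !gK.
by exists (additive_of gB); exists f.
Qed.

Lemma zmod_iso_trans U V W : zmod_iso U V -> zmod_iso V W -> zmod_iso U W.
Proof.
move=> [f fb] [g gb]; exists (g \o f).
exact: bij_comp.
Qed.

Lemma quot_iso (V W : zmodType) (S : zmodClosed V) (g : {additive V -> W}) :
  (forall x, x \in S <-> g x = 0) -> (forall y, exists x, g x = y) ->
  zmod_iso {ideal_quot S} W.
Proof.
move=> gS gs; have [x /gS//|h hE] := @quot_lift _ _ S g.
exists h; apply: inj_surj_bij.
  apply: additive_inj => y; have [x <-] := quot_piP y.
  by rewrite hE => /gS/quot_pi_eq0.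
by move=> y; have [x <-] := gs y; exists (quot_pi S x).
Qed.

Record chain_map (C D : chain_complex) := ChainMap {
  cmap :> forall k, {additive C k -> D k};
  cmap_diff : forall k x, diff D k (cmap k.+1 x) = cmap k (diff C k x)
}.

Section ChainMap.
Variables (C D : chain_complex) (f : chain_map C D).

Lemma cmap_bd k x : bd D k (f k x) = f k.-1 (bd C k x).
Proof. by case: k x => [|k] x; [rewrite /= raddf0|apply: cmap_diff]. Qed.

Lemma cmap_degid i k x : degid D i k (f i x) = f k (degid C i k x).
Proof.
have [<-|ik] := eqVneq i k; first by rewrite /= !degid_eq.
by rewrite /= !degid_neq // raddf0.
Qed.

Lemma cmap_cdiff i k x : cdiff D i k (f i x) = f k (cdiff C i k x).
Proof. by rewrite -[LHS]/(degid D _ _ (bd D i _)) cmap_bd cmap_degid. Qed.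

Definition kernel_acyclic := forall k x, f k x = 0 -> bd C k x = 0 ->
  exists2 y, f k.+1 y = 0 & diff C k y = x.

Lemma bd_diff k x : bd C k (diff C k x) = 0.
Proof. by case: k x => //= k x; apply: diff_diff. Qed.

(** A surjection of complexes with acyclic kernel is a quasi-isomorphism; the diagram chase is done
    directly, without a long exact sequence. *)
Lemma homology_iso k : (forall k y, exists x, f k x = y) -> kernel_acyclic ->
  zmod_iso (homology C k) (homology D k).
Proof.
move=> fs fK.
have fZ (z : cycles C k) : f k (val z) \in addkernel (bd D k).
  by apply/eqP; rewrite cmap_bd (eqP (valP z)) raddf0.
pose Z (z : cycles C k) : cycles D k := Sub (f k (val z)) (fZ z).
have ZB : zmod_morphism Z.
  by move=> z z'; apply: val_inj; rewrite /= !raddfB.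
apply: (quot_iso (g := quot_pi (@boundaries D k) \o additive_of ZB)) => [z|].
  apply: (iff_trans _ (iff_sym (quot_pi_eq0 _ _))); split.
    move=> /asboolP[y yE]; apply/asboolP; exists (f k.+1 y).
    by rewrite cmap_diff yE.
  move=> /asboolP[y' /= yE]; have [y fy] := fs k.+1 y'.
  have [||e _ eE] := fK k (val z - diff C k y).
  - by rewrite raddfB -cmap_diff fy yE subrr.
  - by rewrite raddfB bd_diff subr0; apply/eqP/(valP z).
  by apply/asboolP; exists (e + y); rewrite raddfD eE subrK.
move=> y; have [z <-] := quot_piP y.
have [c fc] := fs k (val z).
(* The lift c of a cycle need not be a cycle, but its boundary is a cycle of the kernel, hence the
   boundary of some e in the kernel, and c - e is the corrected lift. In degree 0 there is nothing
   to correct. *)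
have [e fe eE] : exists2 e, f k e = 0 & bd C k e = bd C k c.
  case: k z c fc {fZ Z ZB y} => [|k] z c fc; first by exists 0; rewrite ?raddf0.
  have [||e fe eE] := fK k (bd C k.+1 c).
  - by rewrite -(cmap_bd (k := k.+1)) fc; apply/eqP/(valP z).
  - exact: bd_diff.
  by exists e.
have cZ : c - e \in addkernel (bd C k) by apply/eqP; rewrite raddfB eE subrr.
exists (Sub (c - e) cZ : cycles C k); congr (quot_pi _ _).
by apply: val_inj; rewrite /= raddfB fe subr0.
Qed.
End ChainMap.

Section Multidegrees.
Variables (n : nat) (P : 'I_n -> chain_complex).

Lemma multideg_down k (M : multideg n k.+1) j : (0 < mdeg M j)%N ->
  exists m : multideg n k, M = multideg_up m j.
Proof.
move=> Mj.
have sumM : (\sum_i mdeg M i = k.+1)%N by apply/eqP/(valP M).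
pose d i := (mdeg M i - (i == j))%N.
have dE i : mdeg M i = (d i + (i == j))%N.
  by rewrite /d subnK //; case: eqP => // ->.
have sumd : (\sum_i d i = k)%N.
  apply/eqP; rewrite -(eqn_add2r 1) [X in _ == X]addn1 -sumM.
  rewrite [X in _ == X](eq_bigr (fun i => d i + (i == j))%N) => [|i _];
    last exact: dE.
  by rewrite big_split /= eqn_add2l (bigD1 j) //= eqxx big1 // => i /negPf->.
have dk i : (d i < k.+1)%N.
  by rewrite ltnS -[X in (_ <= X)%N]sumd (bigD1 i) //= leq_addr.
pose v : {ffun 'I_n -> 'I_k.+1} := [ffun i => Ordinal (dk i)].
have vk : (\sum_i v i == k)%N.
  by rewrite -[X in _ == X]sumd; apply/eqP/eq_bigr => i _; rewrite ffunE.
exists (exist _ v vk); apply: mdeg_inj => i.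
by rewrite mdeg_up {2}/mdeg ffunE dE.
Qed.

Lemma multideg_up_inj k j : injective (fun m : multideg n k => multideg_up m j).
Proof.
move=> m m' mm'; apply: mdeg_inj => i; apply/eqP.
by rewrite -(eqn_add2r (i == j)) -!mdeg_up mm'.
Qed.

Lemma koszul_signK k (m : multideg n k) j (V : zmodType) (x : V) :
  x *~ koszul_sign m j *~ koszul_sign m j = x.
Proof. by rewrite -mulrzA -expr2 sqrr_sign. Qed.

Lemma tens_diffE k (x : tens_chain P k.+1) m :
  tens_diff P k x m = \sum_i tens_diff_entry P (multideg_up m i) m i
    (x (multideg_up m i)) *~ koszul_sign (multideg_up m i) i.
Proof.
rewrite ffunE exchange_big /=; apply: eq_bigr => j _.
rewrite (bigD1 (multideg_up m j)) //= big1 ?addr0 // => m' m'm.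
have [i mi] : exists i, mdeg m' i != (mdeg m i + (i == j))%N.
  apply/existsP; apply: contraNT m'm => /existsPn m'm; apply/eqP.
  by apply: mdeg_inj => i; rewrite mdeg_up; apply/eqP/negPn.
by rewrite (tens_diff_entry_neq _ mi) mul0rz.
Qed.
End Multidegrees.

Section TensorChainMap.
Variables (n : nat) (C D : 'I_n -> chain_complex).
Variable f : forall i, chain_map (C i) (D i).

Definition tens_cmap_fun k (x : tens_chain C k) : tens_chain D k :=
  [ffun m => tens_map (fun i => f i (mdeg m i)) (x m)].

Lemma tens_cmap_fun_is_zmod_morphism k : zmod_morphism (@tens_cmap_fun k).
Proof. by move=> x y; apply/ffunP => m; rewrite dsumBE !ffunE raddfB. Qed.

Definition tens_cmap_deg k : {additive tens_chain C k -> tens_chain D k} :=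
  additive_of (@tens_cmap_fun_is_zmod_morphism k).

Lemma tens_cmapE k (x : tens_chain C k) m :
  tens_cmap_deg k x m = tens_map (fun i => f i (mdeg m i)) (x m).
Proof. by rewrite ffunE. Qed.

Lemma tens_cmap_entry k k' (m : multideg n k) (m' : multideg n k') j x :
  tens_diff_entry D m m' j (tens_map (fun i => f i (mdeg m i)) x) =
  tens_map (fun i => f i (mdeg m' i)) (tens_diff_entry C m m' j x).
Proof.
pose h i : {additive C i (mdeg m i) -> D i (mdeg m' i)} :=
  f i (mdeg m' i) \o (if i == j then cdiff (C i) (mdeg m i) (mdeg m' i)
                      else degid (C i) (mdeg m i) (mdeg m' i)).
apply: (etrans (y := tens_map h x)); last first.
  by apply/esym/tens_map_comp.
apply: tens_map_comp => i y; rewrite /h /=; case: eqP => _.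
  exact: cmap_cdiff.
exact: cmap_degid.
Qed.

Lemma tens_cmap_diff k x :
  tens_diff D k (tens_cmap_deg k.+1 x) = tens_cmap_deg k (tens_diff C k x).
Proof.
apply/ffunP => m; rewrite tens_diffE tens_cmapE tens_diffE raddf_sum.
by apply: eq_bigr => i _; rewrite tens_cmapE tens_cmap_entry raddfMz.
Qed.

Definition tens_cmap : chain_map (tens_complex C) (tens_complex D) :=
  @ChainMap (tens_complex C) (tens_complex D) tens_cmap_deg tens_cmap_diff.

Hypothesis f_surj : forall i k y, exists x, f i k x = y.

Lemma tens_cmap_surj k y : exists x, tens_cmap k x = y.
Proof.
have fm (m : multideg n k) : exists x, tens_map (fun i => f i (mdeg m i)) x = y m.
  by apply: tens_map_surj => i; apply: f_surj.
have [x xE] := fin_all_exists fm.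
by exists [ffun m => x m]; apply/ffunP => m; rewrite tens_cmapE ffunE xE.
Qed.

Variable j : 'I_n.
Hypothesis C_flat : forall i, i != j -> forall k, zflat (C i k).
Hypothesis f_inv : forall i, i != j -> forall k,
  exists g : {additive D i k -> C i k}, cancel (f i k) g.
Hypothesis f_acyclic : kernel_acyclic (f j).
Hypothesis fS0 : forall k x, f j k.+1 x = 0.

Lemma tens_cmap_pos k (m : multideg n k) x :
  (0 < mdeg m j)%N -> tens_map (fun i => f i (mdeg m i)) x = 0.
Proof.
by move=> mj; apply: (@tens_map0 _ _ _ _ j); case: (mdeg m j) mj => // p _ y.
Qed.

Lemma degid_mdeg_up_surj k (m : multideg n k) i : i != j ->
  forall y, exists x, degid (C i) (mdeg (multideg_up m j) i) (mdeg m i) x = y.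
Proof.
move=> ij y; exists (degid (C i) (mdeg m i) (mdeg (multideg_up m j) i) y).
have e : mdeg (multideg_up m j) i = mdeg m i by rewrite mdeg_up (negPf ij) addn0.
by rewrite degid_degid //= degid_eq.
Qed.

Lemma degid_mdeg_up_inv k (m : multideg n k) i : i != j ->
  cancel (degid (C i) (mdeg (multideg_up m j) i) (mdeg m i))
         (degid (C i) (mdeg m i) (mdeg (multideg_up m j) i)).
Proof.
move=> ij y.
have e : mdeg (multideg_up m j) i = mdeg m i by rewrite mdeg_up (negPf ij) addn0.
by rewrite degid_degid //= degid_eq.
Qed.

(** The degrees are variables subject to equations because the entries of [multideg_up m j] are
    successors only propositionally. *)
Lemma cdiff_exact0 a b y : a = 1%N -> b = 0%N -> f j b y = 0 ->
  exists x, cdiff (C j) a b x = y.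
Proof.
move=> aE bE; subst a b => fy; have [|x _ xE] := f_acyclic fy; first by [].
by exists x; rewrite cdiffS.
Qed.

Lemma cdiff_exactS a b c y : a = b.+1 -> b = c.+1 -> cdiff (C j) b c y = 0 ->
  exists x, cdiff (C j) a b x = y.
Proof.
move=> aE bE; subst a b; rewrite cdiffS => yd.
have [||x _ xE] := @f_acyclic c.+1 y; [exact: fS0|exact: yd|].
by exists x; rewrite cdiffS.
Qed.

Lemma tens_slot_exact0 k (m : multideg n k) x : mdeg m j = 0%N ->
  tens_map (fun i => f i (mdeg m i)) x = 0 ->
  exists z, tens_diff_entry C (multideg_up m j) m j z = x.
Proof.
move=> mj; apply: (tens_exact (j := j)) => [y|i ij].
  by rewrite eqxx; apply: cdiff_exact0; rewrite ?mdeg_up ?mj ?eqxx.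
rewrite (negPf ij); split; first exact: C_flat.
  exact: degid_mdeg_up_surj.
exact: f_inv.
Qed.

(** [tens_exact] with the differential of C j in factor j and degree identifications elsewhere;
    there D j has nothing to contribute, since f j vanishes in positive degrees. *)
Lemma tens_slot_exactS k (m : multideg n k) x :
  tens_diff_entry C (multideg_up m j) m j x = 0 ->
  exists z, tens_diff_entry C (multideg_up (multideg_up m j) j)
    (multideg_up m j) j z = x.
Proof.
apply: (tens_exact (j := j)) => [y|i ij].
  by rewrite eqxx; apply: cdiff_exactS; rewrite !mdeg_up eqxx !addn1.
rewrite (negPf ij); split; first exact: C_flat.
  exact: degid_mdeg_up_surj.
by exists (degid (C i) (mdeg m i) (mdeg (multideg_up m j) i));
  apply: degid_mdeg_up_inv.
Qed.

(* The kernel is exhausted by the degree p in direction j: the component of x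
   of lowest degree p in that direction is a cycle for the differential in
   direction j, hence can be cancelled by a boundary. *)
Lemma tens_cmap_filtration k (x : tens_chain C k) p :
  tens_cmap k x = 0 -> bd (tens_complex C) k x = 0 ->
  exists2 y : tens_chain C k.+1, tens_cmap k.+1 y = 0 &
  forall m, (mdeg m j < p)%N -> (x - tens_diff C k y) m = 0.
Proof.
move=> fx dx; elim: p => [|p [y fy yP]]; first by exists 0; rewrite ?raddf0.
set x' := x - tens_diff C k y in yP.
have fx' : tens_cmap k x' = 0.
  by rewrite raddfB fx -(cmap_diff tens_cmap) fy raddf0 subr0.
have dx' : bd (tens_complex C) k x' = 0.
  by rewrite raddfB dx (bd_diff (C := tens_complex C)) subr0.
have slot m : mdeg m j = p ->
    exists z, tens_diff_entry C (multideg_up m j) m j z = x' m.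
  case: p yP => [|p] yP mj.
    by apply: tens_slot_exact0; rewrite // -tens_cmapE [tens_cmap_deg _ _]fx' ffunE.
  case: k x y fx dx fy x' yP fx' dx' m mj => [|k] x y fx dx fy x' yP fx' dx' m mj.
    have := valP m; rewrite (bigD1 j) //= addn_eq0 => /andP[/eqP mj0 _].
    by rewrite /mdeg mj0 in mj.
  have [m' mE] : exists m' : multideg n k, m = multideg_up m' j.
    by apply: multideg_down; rewrite mj.
  subst m; apply: tens_slot_exactS.
  (* At m' only direction j survives: the other multidegrees above m' have a j-entry smaller than
     that of m, where x' is already zero. *)
  move/ffunP/(_ m'): dx'; rewrite [LHS]tens_diffE (bigD1 j) //= big1 ?addr0.
    by move=> e; rewrite -[LHS](koszul_signK (multideg_up m' j) j) e ffunE mul0rz.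
  move=> i ij; rewrite yP ?raddf0 ?mul0rz //.
  by move: mj; rewrite !mdeg_up eqxx eq_sym (negPf ij) addn1 addn0 => -[->].
(* The correction is supported where the j-entry is p + 1. It is positive there, so the correction
   lies in the kernel of the chain map automatically, and its differential leaves the entries below
   p untouched. *)
have exz (M : multideg n k.+1) : exists z : tens (fun i => C i (mdeg M i)),
    [/\ tens_map (fun i => f i (mdeg M i)) z = 0, mdeg M j != p.+1 -> z = 0 &
     forall m, mdeg m j = p -> M = multideg_up m j ->
       tens_diff_entry C M m j z *~ koszul_sign M j = x' m].
  have [Mp|Mp] := eqVneq (mdeg M j) p.+1; last first.
    exists 0; split=> //; first by rewrite raddf0.
    by move=> m mj ME; move: Mp; rewrite ME mdeg_up eqxx mj addn1 eqxx.
  have [m ME] : exists m, M = multideg_up m j by apply: multideg_down; rewrite Mp.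
  have mp : mdeg m j = p by move: Mp; rewrite ME mdeg_up eqxx addn1 => -[].
  subst M; have [z zE] := slot m mp.
  exists (z *~ koszul_sign (multideg_up m j) j); split=> //.
    by rewrite tens_cmap_pos // Mp.
  move=> m' _ /multideg_up_inj <-.
  by rewrite raddfMz zE koszul_signK.
have [z zP] := fin_all_exists exz.
pose Z : tens_chain C k.+1 := [ffun M => z M].
exists (y + Z).
  rewrite raddfD fy add0r; apply/ffunP => M; rewrite tens_cmapE !ffunE.
  by have [-> _ _] := zP M.
move=> m; rewrite ltnS leq_eqVlt raddfD opprD addrA dsumBE => mp.
have -> : tens_diff C k Z m = tens_diff_entry C (multideg_up m j) m j
    (z (multideg_up m j)) *~ koszul_sign (multideg_up m j) j.
  rewrite tens_diffE (bigD1 j) //= big1 ?addr0 ?ffunE // => i ij.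
  have [_ z0 _] := zP (multideg_up m i); rewrite ffunE z0 ?raddf0 ?mul0rz //.
  rewrite mdeg_up (eq_sym j) (negPf ij) addn0.
  by case/orP: mp => [/eqP->|mp]; rewrite neq_ltn ?ltnSn // ltnW.
case/orP: mp => [/eqP mp|mp].
  by have [_ _ ->//] := zP (multideg_up m j); rewrite subrr.
have [_ z0 _] := zP (multideg_up m j); rewrite z0 ?raddf0 ?mul0rz ?subr0 ?yP //.
by rewrite mdeg_up eqxx addn1 eqSS neq_ltn mp.
Qed.

Lemma tens_kernel_acyclic : kernel_acyclic tens_cmap.
Proof.
(* No entry of a multidegree of total degree k reaches k + 1, so at this stage of the filtration
   everything is cancelled. *)
move=> k x fx dx; have [y fy yP] := tens_cmap_filtration k.+1 fx dx.
exists y => //; apply/esym/eqP; rewrite -subr_eq0; apply/eqP/ffunP => m.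
rewrite [LHS]yP ?ffunE //; exact: ltn_ord.
Qed.

Lemma tens_homology_iso k :
  zmod_iso (homology (tens_complex C) k) (homology (tens_complex D) k).
Proof. exact: homology_iso tens_cmap_surj tens_kernel_acyclic. Qed.
End TensorChainMap.

(** * Independence of the resolutions *)

Section TwoTerm.
Variables (U V : zmodType) (d : {additive U -> V}).

(** ['I_1] serves as the zero group. *)
Definition two_term_chain (k : nat) : zmodType :=
  match k with 0 => V | 1 => U | _ => 'I_1 end.

Definition two_term_diff k : {additive two_term_chain k.+1 -> two_term_chain k} :=
  match k with 0 => d | 1 => \0 | _ => \0 end.

Lemma two_term_diff_diff k x : two_term_diff k (two_term_diff k.+1 x) = 0.
Proof. by case: k x => [|[|k]] x //=; rewrite raddf0. Qed.

Definition two_term : chain_complex := ChainComplex two_term_diff_diff.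
End TwoTerm.

Definition concentrated (A : zmodType) : chain_complex :=
  two_term (\0 : {additive 'I_1 -> A}).

Section Augmentation.
Variables (A : zmodType) (R : flat_resolution A).

Definition aug_map_deg k : {additive R k -> concentrated A k} :=
  match k with 0 => augmentation R | 1 => \0 | _ => \0 end.

Lemma aug_map_diff k x :
  diff (concentrated A) k (aug_map_deg k.+1 x) = aug_map_deg k (diff R k x).
Proof.
case: k x => [|[|k]] x //=; apply/esym/resolution_exact0.
by exists x.
Qed.

Definition aug_map : chain_map R (concentrated A) := ChainMap aug_map_diff.

Lemma aug_map_surj k y : exists x, aug_map k x = y.
Proof.
case: k y => [|k] y; first exact: augmentation_surj.
by exists 0; case: k y => [|k] y; rewrite [RHS]ord1 raddf0.
Qed.

Lemma aug_mapS k x : aug_map k.+1 x = 0.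
Proof. by case: k x. Qed.

Lemma aug_map_acyclic : kernel_acyclic aug_map.
Proof.
move=> [|k] x fx dx.
  by move/resolution_exact0: fx => [y yE]; exists y => //; apply: aug_mapS.
by move/resolution_exact: dx => [y yE]; exists y => //; apply: aug_mapS.
Qed.
End Augmentation.

Section Balance.
Variables (n : nat) (A : zmodType).
Implicit Types R : 'I_n -> flat_resolution A.

Lemma homology_concentrate R j k :
  zmod_iso (homology (tens_complex R) k)
    (homology (tens_complex
       (fun i => if i == j then concentrated A else resolution (R i))) k).
Proof.
have exf i : exists f : chain_map (R i)
    (if i == j then concentrated A else resolution (R i)),
  [/\ forall k y, exists x, f k x = y,
      i != j -> forall k, exists g : {additive _ -> R i k}, cancel (f k) g &
      i = j -> kernel_acyclic f /\ forall k x, f k.+1 x = 0].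
  case: eqVneq => ij.
    exists (aug_map (R i)); split=> // [|_]; first exact: aug_map_surj.
    by split; [apply: aug_map_acyclic|apply: aug_mapS].
  have fd l x : diff (R i) l ((fun=> idfun) l.+1 x) =
      (fun=> idfun) l (diff (R i) l x).
    by [].
  exists (ChainMap fd); split=> [l y|_ l|ji]; first by exists y.
    by exists idfun.
  by case/eqP: ij.
have [f fP] := fin_all_exists exf.
have [_ _ [//|fj fS]] := fP j.
apply: (@tens_homology_iso _ _ _ f _ j) => //.
- by move=> i; have [] := fP i.
- by move=> i ij l; apply: resolution_flat.
- by move=> i; have [] := fP i.
Qed.

(** [Rt t] uses R' in the first t positions. [Rt t] and [Rt t.+1] differ only in position t, so
    concentrating that position in degree 0 gives the same complex for both; a zigzag takes the
    place of a comparison map of resolutions. *)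
Lemma homology_replace R R' k :
  zmod_iso (homology (tens_complex R) k) (homology (tens_complex R') k).
Proof.
pose Rt t (i : 'I_n) := if (i < t)%N then R' i else R i.
have step t : (t <= n)%N ->
    zmod_iso (homology (tens_complex R) k) (homology (tens_complex (Rt t)) k).
  elim: t => [_|t IH tn]; first exact: zmod_iso_refl.
  apply: zmod_iso_trans (IH (ltnW tn)) _.
  apply: zmod_iso_trans (homology_concentrate _ (Ordinal tn) k) _.
  apply: zmod_iso_sym.
  apply: zmod_iso_trans (homology_concentrate _ (Ordinal tn) k) _.
  rewrite (_ : (fun i => _) =
    fun i => if i == Ordinal tn then concentrated A else resolution (Rt t i)).
    exact: zmod_iso_refl.
  apply: funext => i; case: eqP => // it; congr resolution.
  rewrite /Rt ltnS leq_eqVlt.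
  by case: eqP => // e; case: it; apply: val_inj.
have := step n (leqnn n); rewrite (_ : Rt n = R') //.
by apply: funext => i; rewrite /Rt ltn_ord.
Qed.
End Balance.

Lemma torsion_free_sub (M N : zmodType) (f : {additive M -> N}) :
  injective f -> torsion_free N -> torsion_free M.
Proof.
move=> finj Ntf x k xk; apply: finj; rewrite raddf0; apply: (Ntf _ k).
by rewrite -raddfMn xk raddf0.
Qed.

Lemma free_abelian_torsion_free (F : zmodType) : free_abelian F -> torsion_free F.
Proof.
move=> [K [f [g fK gK]]] x k xk.
have gB : zmod_morphism g.
  by move=> u v; apply: (can_inj fK); rewrite raddfB !gK.
apply: (torsion_free_sub (f := additive_of gB)) xk; first exact: can_inj gK.
move=> {}x l xl; apply/eqP/freeg_eqP => z; rewrite coeff0.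
have /eqP : coeff z (x *+ l.+1) = 0 by rewrite xl coeff0.
by rewrite raddfMn mulrn_eq0 => /eqP.
Qed.

Section ExtResolution.
Variables (A : zmodType) (c : free_ext A).

Lemma ext_mid_torsion_free : torsion_free (ext_mid c).
Proof. exact/free_abelian_torsion_free/ext_mid_free. Qed.

Lemma ext_mid_flat : zflat (ext_mid c).
Proof. exact/torsion_free_flat/ext_mid_torsion_free. Qed.

Lemma ext_sub_flat : zflat (ext_sub c).
Proof.
apply: torsion_free_flat; apply: torsion_free_sub (ext_mid_torsion_free).
exact: ext_incl_inj.
Qed.

Let Q := two_term (ext_incl c).

Let Q_flat k : zflat (Q k).
Proof.
case: k => [|[|k]] /=; [exact: ext_mid_flat|exact: ext_sub_flat|].
by apply: torsion_free_flat => x *; rewrite [x]ord1.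
Qed.

Let Q_exact0 x : ext_proj c x = 0 <-> exists y, diff Q 0 y = x.
Proof. exact: ext_exact. Qed.

Let Q_exact k x : diff Q k x = 0 <-> exists y, diff Q k.+1 y = x.
Proof.
split=> [dx|[y <-]]; last exact: diff_diff.
exists 0; rewrite raddf0; case: k x dx => [|[|k]] x /= dx; last 2 first.
- by rewrite [x]ord1.
- by rewrite [x]ord1.
by apply: (@ext_incl_inj _ c); rewrite dx raddf0.
Qed.

Definition ext_resolution : flat_resolution A :=
  @FlatResolution A Q (ext_proj c) Q_flat (@ext_proj_surj _ c) Q_exact0 Q_exact.
End ExtResolution.

(** * The homology in degree n - 1 *)

(** The maps need not split, so they are applied one factor at a time: each stage is the identity,
    hence split, in all factors but one. In [main] the factors from t on are split, and the
    induction lowers this bound. *)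
Lemma tens_map_inj_flat n (B C : 'I_n -> zmodType)
    (f : forall i, {additive B i -> C i}) :
  (forall i, injective (f i)) -> (forall i, zflat (B i)) ->
  (forall i, zflat (C i)) -> injective (tens_map f).
Proof.
suff main t : (t <= n)%N -> forall (B C : 'I_n -> zmodType)
    (f : forall i, {additive B i -> C i}),
    (forall i, injective (f i)) -> (forall i, zflat (B i)) ->
    (forall i, zflat (C i)) ->
    (forall i : 'I_n, (t <= i)%N ->
       exists r : {additive C i -> B i}, cancel (f i) r) ->
    injective (tens_map f).
  move=> finj Bf Cf; apply: (main n) => // i; by rewrite leqNgt ltn_ord.
elim: t => [_|t IH tn] {}B {}C {}f finj Bf Cf fr.
  have [r rP] := fin_all_exists (fun i => fr i (leq0n _)).
  exact: can_inj (tens_mapK rP).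
pose j := Ordinal tn.
pose E i := if i == j then C i else B i.
have exgh i : exists gh : {additive B i -> E i} * {additive E i -> C i},
    [/\ forall x, gh.2 (gh.1 x) = f i x,
        [/\ injective gh.1, injective gh.2 & zflat (E i)],
        i != j -> exists r : {additive E i -> B i}, cancel gh.1 r &
        (t <= i)%N -> exists r : {additive C i -> E i}, cancel gh.2 r].
  rewrite /E; case: (eqVneq i j) => ij.
    exists (f i, idfun : {additive C i -> C i}).
    by split=> [//||//|_]; [by split=> // ? ?|by exists idfun].
  exists (idfun : {additive B i -> B i}, f i).
  split=> [//||_|ti]; [by split=> // ? ?|by exists idfun|].
  apply: fr; rewrite ltn_neqAle ti andbT eq_sym.
  by apply: contraNneq ij => e; apply/eqP/val_inj.
have [gh ghP] := fin_all_exists exgh.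
have hg x : tens_map (fun i => (gh i).2) (tens_map (fun i => (gh i).1) x) =
    tens_map f x.
  by apply: tens_map_comp => i y; have [] := ghP i.
have h_inj : injective (tens_map (fun i => (gh i).2)).
  apply: IH => [|i|i||i ti]; [exact: ltnW|by have [_ []] := ghP i| |exact: Cf|].
    by have [_ []] := ghP i.
  by have [_ _ _ /(_ ti)] := ghP i.
have g_inj : injective (tens_map (fun i => (gh i).1)).
  apply: (@tens_map_inj _ j) => [|i ij]; first by have [_ []] := ghP j.
  by split=> //; have [_ _ /(_ ij)] := ghP i.
by move=> x y; rewrite -!hg => /h_inj/g_inj.
Qed.

Lemma generated_ind (V W : zmodType) (S : V -> Prop) (D : zmodClosed W)
    (f : {additive V -> W}) :
  (forall v, S v -> f v \in D) -> forall v, v \in generated S -> f v \in D.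
Proof.
move=> SD v /asboolP; elim=> {v} [v /SD//||u v _ Du _ Dv].
  by rewrite raddf0 rpred0.
by rewrite raddfB rpredB.
Qed.

Lemma tens_trivial (I : finType) (B : I -> zmodType) i (x : tens B) :
  (forall y : B i, y = 0) -> x = 0.
Proof.
move=> B0; rewrite -(tens_map_id (f := fun i => idfun) _ x) //.
exact: (@tens_map0 _ _ _ _ i).
Qed.

Section Vanishing.
Variables (A : zmodType) (c : free_ext A) (n : nat).

(** These generate the image in F^(x)n of the tensor product with H at the positions in J and F
    elsewhere. Working inside F^(x)n lets the images for different J be compared directly. *)
Definition vanishing (J : pred 'I_n) (w : tpow n (ext_mid c)) : Prop :=
  exists2 x : {dffun forall i : 'I_n, ext_mid c}, w = tpure x &
    forall i, J i -> ext_proj c (x i) = 0.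

Lemma vanishingS (J J' : pred 'I_n) : (forall i, J i -> J' i) ->
  {subset generated (vanishing J') <= generated (vanishing J)}.
Proof.
move=> JJ'; apply: (generated_ind (f := idfun)) => w [x -> x0].
by apply/asboolP/span_gen; exists x => // i /JJ'/x0.
Qed.

Let Q := two_term (ext_incl c).

Definition iota k : {additive Q k -> ext_mid c} :=
  match k with 0 => idfun | 1 => ext_incl c | _ => \0 end.

Lemma iota_inj k : (k <= 1)%N -> injective (iota k).
Proof. by case: k => [|[|k]] // _; [move=> x y|apply: ext_incl_inj]. Qed.

Lemma iota_image k x : (k <= 1)%N ->
  (exists y, iota k y = x) <-> ((0 < k)%N -> ext_proj c x = 0).
Proof.
case: k => [|[|k]] //= _; first by split=> // _; exists x.
by rewrite -ext_exact; split=> //; apply.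
Qed.

Lemma iota_degid a b x : a = b -> iota b (degid Q a b x) = iota a x.
Proof. by move=> e; subst b; rewrite /= degid_eq. Qed.

Lemma iota_cdiff a b x : a = b.+1 ->
  iota b (cdiff Q a b x) = if b == 0%N then iota a x else 0.
Proof.
by move=> e; subst a; rewrite cdiffS; case: b x => [|[|b]] x //=; rewrite raddf0.
Qed.

Definition theta k (m : multideg n k) :
    {additive tens (fun i => Q (mdeg m i)) -> tpow n (ext_mid c)} :=
  tens_map (fun i => iota (mdeg m i)).

Lemma theta_inj k (m : multideg n k) :
  (forall i, mdeg m i <= 1)%N -> injective (theta m).
Proof.
move=> m1; apply: tens_map_inj_flat => i; first exact/iota_inj.
  exact: (@resolution_flat _ (ext_resolution c)  (mdeg m i)).
exact: ext_mid_flat.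
Qed.

(** Inside F^(x)n the differential H -> F is an inclusion and becomes invisible. If the entry at j
    is already positive, the differential entering it is zero. *)
Lemma theta_entry k (m : multideg n k) j x :
  theta m (tens_diff_entry (fun=> Q) (multideg_up m j) m j x) =
  if mdeg m j == 0%N then theta (multideg_up m j) x else 0.
Proof.
pose h i : {additive Q (mdeg (multideg_up m j) i) -> ext_mid c} :=
  if (i == j) && (mdeg m j != 0%N) then (\0 : {additive _ -> _})
  else iota (mdeg (multideg_up m j) i).
apply: (etrans (y := tens_map h x)); last first.
  case: eqP => mj; last first.
    by apply: (@tens_map0 _ _ _ _ j) => y; rewrite /h eqxx; move/eqP: mj => ->.
  by apply: tens_map_ext => i y; rewrite /h mj andbF.
apply: tens_map_comp => i y; rewrite /h; have := mdeg_up m j i.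
have [ij|ij] := eqVneq i j => mi; last by rewrite iota_degid // mi addn0.
subst i; rewrite iota_cdiff; last by rewrite mi addn1.
by case: eqP.
Qed.

Lemma theta_image k (m : multideg n k) w : (forall i, mdeg m i <= 1)%N ->
  (exists t, theta m t = w) <->
  w \in generated (vanishing (fun i => 0 < mdeg m i)%N).
Proof.
move=> m1; split=> [[t <-]|].
  apply/quot_pi_eq0; move: t.
  apply: (tens_ext (f := quot_pi (generated _) \o theta m) (g := \0)) => x.
  apply/quot_pi_eq0/asboolP/span_gen.
  rewrite /= tens_map_pure; eexists; first by [].
  by move=> i; rewrite ffunE; apply/(iota_image _ (m1 i)); exists (x i).
suff sub v : v \in generated (vanishing (fun i => 0 < mdeg m i)%N) ->
    v \in addimage (theta m) by move=> /sub/asboolP.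
apply: (generated_ind (f := idfun)) => {}v [x -> x0]; apply/asboolP.
have ex i : exists y, iota (mdeg m i) y = x i by apply/(iota_image _ (m1 i))/x0.
have [y yP] := fin_all_exists ex.
exists (tpure ([ffun i => y i] : {dffun forall i, Q (mdeg m i)})).
rewrite /= tens_map_pure; congr tpure; apply/ffunP => i.
by rewrite !ffunE yP.
Qed.

Lemma addimage_incl w :
  w \in addimage (tpow_map n (ext_incl c)) <-> w \in generated (vanishing xpredT).
Proof.
split=> [/asboolP[h <-]|].
  apply/quot_pi_eq0; move: h.
  apply: (tens_ext (f := quot_pi (generated _) \o tpow_map n (ext_incl c))
    (g := \0)) => x.
  apply/quot_pi_eq0/asboolP/span_gen.
  rewrite /= tens_map_pure; eexists; first by [].
  by move=> i _; rewrite ffunE; apply/ext_exact; exists (x i).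
apply: (generated_ind (f := idfun)) => v [x -> x0]; apply/asboolP.
have ex i : exists y, ext_incl c y = x i by apply/ext_exact/x0.
have [y yP] := fin_all_exists ex.
exists (tpure ([ffun i => y i] : {dffun forall i, ext_sub c})).
rewrite /= tens_map_pure; congr tpure; apply/ffunP => i.
by rewrite !ffunE yP.
Qed.

Lemma ext_quot_pi_eq0 w :
  ext_quot_pi n c w = 0 <-> w \in generated (vanishing xpredT).
Proof. by rewrite -addimage_incl; apply: quot_pi_eq0. Qed.

(* The value of the limit at c is the intersection over a of the images in
   F^(x)n / H^(x)n of H (x) .. (x) F (x) .. (x) H, with F in position a. *)
Definition lim_val : {pred ext_quot n c} := fun y =>
  `[< forall a : 'I_n, exists2 w, w \in generated (vanishing (predC1 a)) &
      ext_quot_pi n c w = y >].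

Lemma lim_val_zmod_closed : zmod_closed lim_val.
Proof.
split=> [|x y].
  by apply/asboolP => a; exists 0; rewrite ?rpred0 // raddf0.
move=> /asboolP Lx /asboolP Ly; apply/asboolP => a.
have [v va <-] := Lx a; have [w wa <-] := Ly a.
by exists (v - w); rewrite ?rpredB // raddfB.
Qed.
HB.instance Definition _ := GRing.isZmodClosed.Build (ext_quot n c) lim_val
  lim_val_zmod_closed.

(** Representatives for different a differ by elements of H^(x)n, which lies in each of the
    subgroups, so any one of them serves for all a. *)
Lemma lim_valP (y : ext_quot n c) : (0 < n)%N ->
  y \in lim_val ->
  exists2 w, ext_quot_pi n c w = y &
    forall a, w \in generated (vanishing (predC1 a)).
Proof.
move=> n0 /asboolP Ly; have [w _ wy] := Ly (Ordinal n0).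
exists w => // a; have [v va vy] := Ly a; rewrite -[w](subrK v).
apply: rpredD => //; apply: (vanishingS (J' := xpredT)) => //.
by apply/ext_quot_pi_eq0; rewrite raddfB wy vy subrr.
Qed.

Definition lim_val_type : Type := {y : ext_quot n c | y \in lim_val}.
HB.instance Definition _ := SubChoice.on lim_val_type.
HB.instance Definition _ := [SubChoice_isSubZmodule of lim_val_type by <:].
End Vanishing.
Arguments vanishing {A} c {n} J w.
Arguments lim_val {A} c n _.

Lemma koszul_sign_up n k (m : multideg n k) u v :
  koszul_sign (multideg_up m u) v = (-1) ^+ (u < v)%N * koszul_sign m v.
Proof.
rewrite /koszul_sign -exprD addnC; congr (_ ^+ _).
under eq_bigr => i _ do rewrite mdeg_up.
rewrite big_split /=; congr (_ + _)%N.
case: (ltnP u v) => uv; first rewrite (bigD1 u) //= eqxx big1 //.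
  by move=> i /andP[_ /negPf->].
rewrite big1 // => i iv; case: eqP iv => // ->.
by rewrite ltnNge uv.
Qed.

Lemma mdeg_sum n k (m : multideg n k) : (\sum_i mdeg m i = k)%N.
Proof. exact/eqP/(valP m). Qed.

Lemma mdeg_has_zero n k (m : multideg n k) : (k < n)%N ->
  exists a, mdeg m a = 0%N.
Proof.
move=> kn; suff /existsP[a /eqP ma] : [exists a, mdeg m a == 0%N] by exists a.
apply: contraLR kn; rewrite negb_exists -leqNgt.
move=> /forallP m1; rewrite -[k in (_ <= k)%N](mdeg_sum m) -[n in (n <= _)%N]card_ord.
by rewrite -sum1_card; apply: leq_sum => i _; rewrite lt0n m1.
Qed.

Lemma mdeg_all_one n (m : multideg n n) : (forall i, mdeg m i <= 1)%N ->
  forall i, mdeg m i = 1%N.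
Proof.
move=> m1 a; apply/eqP; rewrite eqn_leq m1 lt0n; apply/eqP => ma.
have := mdeg_sum m; rewrite (bigD1 a) //= ma add0n => sn.
have: (\sum_(i < n | i != a) mdeg m i <= \sum_(i < n | i != a) 1)%N.
  by apply: leq_sum => i _.
rewrite sn sum1_card cardC1 card_ord leqNgt prednK ?leqnn //.
exact: leq_ltn_trans (ltn_ord a).
Qed.

Section Omit.
Variable p : nat.
Let n := p.+2.

Definition ones_val : {ffun 'I_n -> 'I_n.+1} := [ffun=> inord 1].

Lemma ones_subproof : (\sum_i ones_val i == n)%N.
Proof.
rewrite (eq_bigr (fun=> 1%N)) => [|i _]; first by rewrite sum1_card card_ord.
by rewrite ffunE inordK.
Qed.

Definition ones : multideg n n := exist _ ones_val ones_subproof.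

Lemma mdeg_ones i : mdeg ones i = 1%N.
Proof. by rewrite /mdeg ffunE inordK. Qed.

Lemma omit_ex a : exists m : multideg n p.+1, ones = multideg_up m a.
Proof. by apply: multideg_down; rewrite mdeg_ones. Qed.

(** The entry is 0 at a and 1 elsewhere. By [omitP] these are the only multidegrees of total degree
    n - 1 at which Q^(x)n can be nonzero. *)
Definition omit a : multideg n p.+1 := sval (cid (omit_ex a)).

Lemma omitE a : multideg_up (omit a) a = ones.
Proof. by rewrite /omit; case: cid. Qed.

Lemma mdeg_omit a i : mdeg (omit a) i = (i != a).
Proof.
have := mdeg_up (omit a) a i; rewrite omitE mdeg_ones.
by case: eqP => /= _; rewrite ?addn1 ?addn0 => // -[].
Qed.

Lemma omit_inj : injective omit.
Proof.
move=> a b ab; have := mdeg_omit a b; rewrite ab mdeg_omit eqxx.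
by case: eqP.
Qed.

Lemma omitP m : (forall i, mdeg m i <= 1)%N -> exists a, m = omit a.
Proof.
move=> m1; have [a ma] := mdeg_has_zero m (ltnSn _).
exists a; apply: (@multideg_up_inj _ _ a); rewrite omitE.
apply: mdeg_inj => i; rewrite mdeg_ones; apply: mdeg_all_one => k.
by rewrite mdeg_up; case: eqP => [->|_]; rewrite ?ma // addn0.
Qed.

Lemma mdeg_omit2 (m : multideg n p) a b i : multideg_up m a = omit b ->
  (mdeg m i + (i == a) + (i == b))%N = 1%N.
Proof. by move=> e; rewrite -mdeg_up e -mdeg_up omitE mdeg_ones. Qed.

Lemma omit2_ex a b : a != b -> exists m : multideg n p, multideg_up m a = omit b.
Proof.
move=> ab; have [|m mE] := @multideg_down n p (omit b) a; last by exists m.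
by rewrite mdeg_omit ab.
Qed.

Lemma omit2P (m : multideg n p) : (forall i, mdeg m i <= 1)%N ->
  exists a b, a != b /\ multideg_up m a = omit b.
Proof.
move=> m1; have [a ma] := mdeg_has_zero m (ltnW (ltnSn _)).
have [|b bE] := @omitP (multideg_up m a).
  by move=> i; rewrite mdeg_up; case: eqP => [->|_]; rewrite ?ma // addn0.
exists a, b; split=> //; apply/negP => /eqP ab.
by have := mdeg_omit2 a bE; rewrite ma ab eqxx.
Qed.

Lemma omit2C (m : multideg n p) a b :
  multideg_up m a = omit b -> multideg_up m b = omit a.
Proof.
move=> e; apply: (@multideg_up_inj _ _ a); rewrite omitE.
apply: mdeg_inj => i; rewrite mdeg_ones -(mdeg_omit2 i e) !mdeg_up.
by rewrite addnAC.
Qed.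

(** This is (-1)^a, as all entries to the left of a are 1. *)
Definition osign (a : 'I_n) : int := koszul_sign ones a.

Lemma osignK a (V : zmodType) (x : V) : x *~ osign a *~ osign a = x.
Proof. exact: koszul_signK. Qed.

Lemma koszul_sign_omit a b :
  koszul_sign (omit b) a = (-1) ^+ (b < a)%N * osign a.
Proof. by rewrite /osign -(omitE b) koszul_sign_up mulrA -expr2 sqrr_sign mul1r. Qed.
End Omit.

(** Multiplication by s * t, whose square is 1, exchanges the two equations. *)
Lemma sign_swap (V : zmodType) (u v : V) (s t : int) : s * s = 1 -> t * t = 1 ->
  u *~ s = v *~ t <-> v *~ s - u *~ t = 0.
Proof.
move=> s1 t1; split=> [e|/eqP].
  have -> : u = v *~ t *~ s by rewrite -e -mulrzA s1 mulr1z.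
  by rewrite -!mulrzA mulrCA t1 mulr1 subrr.
rewrite subr_eq0 => /eqP e.
have -> : u = v *~ s *~ t by rewrite e -mulrzA t1 mulr1z.
by rewrite -!mulrzA mulrCA s1 mulr1.
Qed.

Lemma osign2 p (a : 'I_p.+2) : osign a * osign a = 1.
Proof. by rewrite -expr2 sqrr_sign. Qed.

Section LimitHomology.
Variables (p : nat) (A : zmodType) (c : free_ext A).
Let n := p.+2.
Let Q := two_term (ext_incl c).
Let QQ (_ : 'I_n) : chain_complex := Q.

Definition coord k (z : tens_chain QQ k) (m : multideg n k) :
  tpow n (ext_mid c) := theta c m (z m).

Lemma coordB k (y z : tens_chain QQ k) m : coord (y - z) m = coord y m - coord z m.
Proof. by rewrite /coord dsumBE raddfB. Qed.

Lemma coord_diff k (z : tens_chain QQ k.+1) m : coord (tens_diff QQ k z) m =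
  \sum_(i | mdeg m i == 0%N)
     coord z (multideg_up m i) *~ koszul_sign (multideg_up m i) i.
Proof.
rewrite /coord tens_diffE raddf_sum [RHS]big_mkcond; apply: eq_bigr => i _.
by rewrite raddfMz theta_entry; case: eqP => // _; rewrite mul0rz.
Qed.

(** Here m is 0 exactly at a and b, so only these two directions contribute. Their signs are
    opposite apart from [osign], since exactly one of a and b lies to the left of the other. *)
Lemma coord_diff_omit2 (z : tens_chain QQ p.+1) (m : multideg n p) a b :
  a != b -> multideg_up m a = omit b ->
  coord (tens_diff QQ p z) m =
  (coord z (omit b) *~ osign a - coord z (omit a) *~ osign b) *~ (-1) ^+ (b < a)%N.
Proof.
move=> ab e; have e' := omit2C e; have mi i := mdeg_omit2 i e.
have ma : mdeg m a = 0%N.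
  by have := mi a; rewrite eqxx (negPf ab) /= addn0 addn1 => -[].
have mb : mdeg m b = 0%N.
  by have := mi b; rewrite eqxx eq_sym (negPf ab) /= addn0 addn1 => -[].
rewrite coord_diff (bigD1 a) ?ma //= (bigD1 b) ?mb 1?eq_sym //= big1 ?addr0.
  rewrite e e' !koszul_sign_omit mulrzBl -!mulrzA ![osign _ * _]mulrC.
  congr (_ + _); rewrite -mulrNz -mulNr; congr (_ *~ (_ * _)).
  by case: ltngtP ab => // /val_inj->; rewrite eqxx.
move=> i /andP[/andP[mi0 ia] ib].
by have := mi i; rewrite (eqP mi0) (negPf ia) (negPf ib).
Qed.

Lemma coord_diff_omit (y : tens_chain QQ n) a :
  coord (tens_diff QQ p.+1 y) (omit a) = coord y (ones p) *~ osign a.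
Proof.
rewrite coord_diff (big_pred1 a) ?omitE // => i.
by rewrite mdeg_omit eqb0 negbK.
Qed.

Lemma tens_chain_eq0 k (z : tens_chain QQ k) :
  (forall m, (forall i, mdeg m i <= 1)%N -> coord z m = 0) -> z = 0.
Proof.
move=> z0; apply/ffunP => m; rewrite [RHS]ffunE.
case: (boolP [forall i, mdeg m i <= 1]%N) => [/forallP m1|].
  by apply: (theta_inj m1); rewrite raddf0; apply: z0.
rewrite negb_forall => /existsP[i mi]; apply: (@tens_trivial _ _ i).
by rewrite /QQ /=; case: (mdeg m i) mi => [|[|d]] //= _ y; rewrite [y]ord1.
Qed.

Lemma cycle_coord (z : tens_chain QQ p.+1) :
  tens_diff QQ p z = 0 <-> forall a b,
    coord z (omit a) *~ osign a = coord z (omit b) *~ osign b.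
Proof.
have step a b :=
  sign_swap (coord z (omit a)) (coord z (omit b)) (osign2 a) (osign2 b).
split=> [dz a b|e].
  have [->//|ab] := eqVneq a b; apply/step.
  have [m mE] := omit2_ex ab.
  have := coord_diff_omit2 z ab mE; rewrite dz /coord ffunE raddf0 => /esym.
  by case: (b < a)%N => /=; rewrite ?expr1 ?expr0 ?mulrNz ?mulr1z // => /eqP;
    rewrite oppr_eq0 => /eqP.
apply: tens_chain_eq0 => m /omit2P[a [b [ab mE]]].
by rewrite (coord_diff_omit2 _ ab mE) (step a b).1 ?mul0rz.
Qed.

Lemma coord_vanishing (z : tens_chain QQ p.+1) a s :
  coord z (omit a) *~ s \in generated (vanishing c (predC1 a)).
Proof.
rewrite rpredMz //; apply: (@vanishingS _ _ _ _ (fun i => 0 < mdeg (omit a) i)%N).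
  by move=> i /= ia; rewrite mdeg_omit ia.
apply/theta_image; last by exists (z (omit a)).
by move=> i; rewrite mdeg_omit; case: eqP.
Qed.

Let o : 'I_n := ord0.

Lemma lim_val_cycle (z : cycles (tens_complex QQ) p.+1) :
  ext_quot_pi n c (coord (val z) (omit o) *~ osign o) \in lim_val c n.
Proof.
apply/asboolP => a; exists (coord (val z) (omit a) *~ osign a).
  exact: coord_vanishing.
have /cycle_coord dz : tens_diff QQ p (val z) = 0 by apply/eqP/(valP z).
by rewrite (dz a o).
Qed.

Lemma ones_image w : w \in generated (vanishing c xpredT) <->
  exists t, theta c (ones p) t = w.
Proof.
rewrite theta_image; last by move=> i; rewrite mdeg_ones.
split; apply: vanishingS => i //=; by rewrite mdeg_ones.
Qed.

Lemma homology_lim_val :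
  zmod_iso (homology (tens_complex QQ) p.+1) (lim_val_type c n).
Proof.
pose g (z : cycles (tens_complex QQ) p.+1) : lim_val_type c n :=
  Sub (ext_quot_pi n c (coord (val z) (omit o) *~ osign o)) (lim_val_cycle z).
have gB : zmod_morphism g.
  by move=> x y; apply: val_inj; rewrite /= [coord (_ - _) _]coordB mulrzBl raddfB.
apply: (quot_iso (g := additive_of gB)) => [z|y].
  apply: (iff_trans (B := coord (val z) (omit o) *~ osign o \in
     generated (vanishing c xpredT))); last first.
    by rewrite -ext_quot_pi_eq0; split=> [e|/(congr1 val)//]; apply: val_inj.
  rewrite ones_image; split.
    move=> /asboolP[y yE]; exists (y (ones p)).
    by rewrite -yE [coord _ _]coord_diff_omit osignK.
  have /cycle_coord dz : tens_diff QQ p (val z) = 0 by apply/eqP/(valP z).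
  move=> [t tE]; apply/asboolP.
  (* The type of y depends on M, so the prescribed value at [ones] is guarded by an equation, with 0
     at all other multidegrees. *)
  have exy (M : multideg n n) : exists y : tens (fun i => QQ i (mdeg M i)),
      M = ones p -> theta c M y = coord (val z) (omit o) *~ osign o.
    have [ME|ME] := eqVneq M (ones p); first by subst M; exists t.
    by exists 0 => e; case/eqP: ME.
  have [y yP] := fin_all_exists exy.
  pose Y : tens_chain QQ n := [ffun M => y M].
  have cY : coord Y (ones p) = coord (val z) (omit o) *~ osign o.
    by rewrite /coord ffunE yP.
  exists Y; suff: tens_diff QQ p.+1 Y - val z = 0.
    by move/eqP; rewrite subr_eq0 => /eqP.
  apply: tens_chain_eq0 => m /omitP[a ->].
  by rewrite coordB coord_diff_omit cY (dz o a) osignK subrr.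
have [w wy wa] := lim_valP (ltn0Sn _) (valP y).
have ext (m : multideg n p.+1) : exists t : tens (fun i => QQ i (mdeg m i)),
    forall a, m = omit a -> theta c m t = w *~ osign a.
  case: (pselect (exists a, m = omit a)) => [[a mE]|no]; last first.
    by exists 0 => a mE; case: no; exists a.
  subst m; have [t tE] : exists t, theta c (omit a) t = w *~ osign a.
    apply/theta_image; first by move=> i; rewrite mdeg_omit; case: eqP.
    rewrite rpredMz //; apply: vanishingS (wa a) => i.
    by rewrite mdeg_omit /=; case: eqP.
  by exists t => b /omit_inj <-.
have [t tP] := fin_all_exists ext.
pose z : tens_chain QQ p.+1 := [ffun m => t m].
have zE a : coord z (omit a) = w *~ osign a by rewrite /coord ffunE (tP _ a).
have zZ : z \in addkernel (bd (tens_complex QQ) p.+1).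
  by apply/eqP/cycle_coord => a b; rewrite !zE !osignK.
exists (Sub z zZ : cycles (tens_complex QQ) p.+1); apply: val_inj.
by rewrite /= -[X in _ = X]wy; congr (ext_quot_pi _ _ _); rewrite zE osignK.
Qed.
End LimitHomology.

(** * The limit over free extensions *)

(** The universal property of a free group, in the form used below: maps are built, and equalities
    checked, on basis elements. *)
Definition is_basis (F : zmodType) (K : Type) (e : K -> F) : Prop :=
  (forall (V : zmodType) (g : K -> V),
     exists f : {additive F -> V}, forall k, f (e k) = g k) /\
  (forall (V : zmodType) (f g : {additive F -> V}),
     (forall k, f (e k) = g (e k)) -> f =1 g).

Lemma freeg_basis (K : choiceType) : is_basis (fun k : K => << k >> : {freeg K}).
Proof.
split=> V g; last first.
  move=> h gh x; rewrite -[x]freeg_sumE !raddf_sum; apply: eq_bigr => z _.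
  by rewrite -[coeff z _]intz -freegU_mulz !raddfMz gh.
pose f : {freeg K} -> V := fglift (g : K -> zmodule V).
have fB : zmod_morphism f.
  by move=> x y; apply: (@lift_is_additive int _ (zmodule V) g).
by exists (additive_of fB) => k; rewrite /= /f liftU scale1r.
Qed.

Definition ker_type (U V : zmodType) (f : {additive U -> V}) : Type :=
  {x : U | x \in addkernel f}.
HB.instance Definition _ U V f := SubChoice.on (@ker_type U V f).
HB.instance Definition _ U V f :=
  [SubChoice_isSubZmodule of (@ker_type U V f) by <:].

Section Extensions.
Variable A : zmodType.

Lemma free_presentation (K : choiceType) (s : K -> A) :
  (forall a, exists k, s k = a) ->
  exists (c : free_ext A) (e : K -> ext_mid c),
    is_basis e /\ forall k, ext_proj c (e k) = s k.
Proof.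
move=> s_surj; have [lift _] := freeg_basis K.
have [pr prE] := lift A s.
have inclB : zmod_morphism (val : ker_type pr -> {freeg K}) by exact: raddfB.
have incl_inj : injective (additive_of inclB) by exact: val_inj.
have pr_surj a : exists x, pr x = a.
  by have [k <-] := s_surj a; exists << k >>; apply: prE.
have exact x : pr x = 0 <-> exists h, additive_of inclB h = x.
  split=> [px|[h <-]]; last exact/eqP/(valP h).
  have xK : x \in addkernel pr by apply/eqP.
  by exists (Sub x xK : ker_type pr).
have free : free_abelian {freeg K} by exists K, idfun; exists id.
exists (FreeExt incl_inj pr_surj exact free), (fun k => << k >>).
by split=> //; apply: freeg_basis.
Qed.

Lemma ext_hom_lift (c c' : free_ext A) (u : {additive ext_mid c -> ext_mid c'}) :
  (forall x, ext_proj c' (u x) = ext_proj c x) ->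
  exists h : ext_hom c c', hom_mid h = u.
Proof.
move=> up; have exs y : exists y', ext_incl c' y' = u (ext_incl c y).
  by apply/ext_exact; rewrite up; apply/ext_exact; exists y.
have [s sE] := choice exs.
have sB : zmod_morphism s.
  by move=> x y; apply: (@ext_incl_inj _ c'); rewrite raddfB !sE !raddfB.
have inclE h : u (ext_incl c h) = ext_incl c' (additive_of sB h) by rewrite sE.
by exists (ExtHom inclE up).
Qed.

Lemma ext_hom_based (K : Type) (c c' : free_ext A) (e : K -> ext_mid c)
    (g : K -> ext_mid c') :
  is_basis e -> (forall k, ext_proj c' (g k) = ext_proj c (e k)) ->
  exists h : ext_hom c c', forall k, hom_mid h (e k) = g k.
Proof.
move=> [lift uniq_ext] ge; have [u uE] := lift _ g.
have up x : ext_proj c' (u x) = ext_proj c x.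
  move: x; apply: (uniq_ext _ (ext_proj c' \o u) (ext_proj c)) => k /=.
  by rewrite uE ge.
have [h hE] := ext_hom_lift up.
by exists h => k; rewrite hE.
Qed.

Variable n : nat.

(* Telescoping: g^(x)n - f^(x)n is a sum of terms
   g (x) .. (x) (g - f) (x) .. (x) f, where g - f takes values in H, while f and
   g map H into H. *)
Lemma ext_quot_map_homotopy (c c' : free_ext A) (f g : ext_hom c c') y :
  (0 < n)%N -> y \in lim_val c n -> ext_quot_map n f y = ext_quot_map n g y.
Proof.
move=> n0 /lim_valP -/(_ n0)[w <- wa].
rewrite [LHS]ext_quot_map_fun_pi [RHS]ext_quot_map_fun_pi.
pose M t : {additive tpow n (ext_mid c) -> tpow n (ext_mid c')} :=
  tens_map (fun i : 'I_n => if (i < t)%N then hom_mid g else hom_mid f).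
have step t : (t <= n)%N ->
    ext_quot_pi n c' (M t w) = ext_quot_pi n c' (M 0%N w).
  elim: t => // t IH tn; rewrite -IH ?(ltnW tn) //.
  apply/eqP; rewrite -subr_eq0 -raddfB; apply/eqP/ext_quot_pi_eq0.
  pose D : {additive tpow n (ext_mid c) -> tpow n (ext_mid c')} := M t.+1 \- M t.
  rewrite -[_ - _]/(D w).
  (* [M t.+1] and [M t] differ only in position t, so w is written with its free entry exactly
     there: the difference of g and f sends F into H at t, and the other entries are in H
     already. *)
  pose j := Ordinal tn; apply: (generated_ind _ (wa j)) => _ [x -> x0].
  pose mt s (i : 'I_n) := (if (i < s)%N then hom_mid g else hom_mid f) (x i).
  pose d i := if i == j then hom_mid g (x i) - hom_mid f (x i) else mt t i.
  have -> : D (tpure x) = tpure [ffun i => d i].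
    apply/eqP; rewrite /D /= subr_eq !tens_map_pure; apply/eqP.
    apply: (@tpure_add _ _ j) => [|i ij|i ij]; rewrite !ffunE.
    - by rewrite /d eqxx ltnSn ltnn subrK.
    - rewrite /d (negPf ij) /mt ltnS leq_eqVlt.
      by have -> : (i == t :> nat) = false by exact: negPf ij.
    - rewrite ltnS leq_eqVlt.
      by have -> : (i == t :> nat) = false by exact: negPf ij.
  apply/asboolP/span_gen; eexists; first by [].
  move=> i _; rewrite ffunE /d; case: eqP => [->|/eqP ij].
    by rewrite raddfB !hom_proj subrr.
  by rewrite /mt; case: ifP => _; rewrite hom_proj x0.
have -> : tpow_map n (hom_mid f) w = M 0%N w by apply: tens_map_ext.
rewrite -(step n) //; congr (ext_quot_pi _ _ _); apply: tens_map_ext => i x.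
by rewrite ltn_ord.
Qed.

(* Two copies of c inside an extension with middle term F + F: a compatible
   family takes the same value along both inclusions, and the projection onto
   the first copy in position a, together with the codiagonal elsewhere,
   recovers it up to an element of H (x) .. (x) F (x) .. (x) H. *)
Lemma limit_in_lim_val (c : free_ext A) (e : A -> ext_mid c)
    (x : forall c, ext_quot n c) :
  is_basis e -> (forall a, ext_proj c (e a) = a) ->
  (forall c1 c2 (u : ext_hom c1 c2), ext_quot_map n u (x c1) = x c2) ->
  x c \in lim_val c n.
Proof.
(* The extension c' is free on two copies of A, each mapping identically to A; [i1] and [i2] are the
   two inclusions of c. *)
move=> eB eE xP; apply/asboolP => a.
have [|c' [e' [e'B e'E]]] := @free_presentation (A + A)%type
  (fun k => match k with inl b => b | inr b => b end).
  by move=> b; exists (inl b).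
have [|i1 i1E] := @ext_hom_based _ c c' e (fun b => e' (inl b)) eB.
  by move=> b; rewrite e'E eE.
have [|i2 i2E] := @ext_hom_based _ c c' e (fun b => e' (inr b)) eB.
  by move=> b; rewrite e'E eE.
have [lift' uniq'] := e'B.
have [pr prE] := lift' _ (fun k => match k with inl b => e b | inr b => 0 end).
have [cod codE] := lift' _ (fun k => match k with inl b => e b | inr b => e b end).
have cod_proj z : ext_proj c (cod z) = ext_proj c' z.
  move: z; apply: (uniq' _ (ext_proj c \o cod) (ext_proj c')) => k /=.
  by rewrite codE e'E; case: k => b; rewrite eE.
have pr1 z : pr (hom_mid i1 z) = z.
  move: z; apply: (eB.2 _ (pr \o hom_mid i1) idfun) => b /=.
  by rewrite i1E prE.
have cod1 z : cod (hom_mid i1 z) = z.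
  move: z; apply: (eB.2 _ (cod \o hom_mid i1) idfun) => b /=.
  by rewrite i1E codE.
have pr2 z : pr (hom_mid i2 z) = 0.
  move: z; apply: (eB.2 _ (pr \o hom_mid i2) \0) => b /=.
  by rewrite i2E prE.
(* Only [cod] respects the projections to A, so p keeps entries in H at every position but a. At a,
   [pr] kills the second copy, so p maps the difference of the two images of w back to w. *)
pose p (b : 'I_n) := if b == a then pr else cod.
have [w wx] := quot_piP (x c).
exists w => //.
have p1 : tens_map p (tpow_map n (hom_mid i1) w) = w.
  rewrite [LHS](@tens_map_comp _ _ _ _ _ _ (fun=> idfun)) ?tens_map_id // => b z.
  by rewrite /p; case: eqP => _; [apply: pr1|apply: cod1].
have p2 : tens_map p (tpow_map n (hom_mid i2) w) = 0.
  rewrite [LHS](@tens_map_comp _ _ _ _ _ _ (fun b => p b \o hom_mid i2)) //.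
  by apply: (@tens_map0 _ _ _ _ a) => z; rewrite /= /p eqxx pr2.
rewrite -p1 -[tens_map p _]subr0 -{}p2 -!raddfB.
have : tpow_map n (hom_mid i1) w - tpow_map n (hom_mid i2) w
    \in generated (vanishing c' xpredT).
  apply/ext_quot_pi_eq0; rewrite raddfB -!ext_quot_map_fun_pi.
  rewrite -[X in X - _]/(ext_quot_map n i1 _).
  rewrite -[X in _ - X]/(ext_quot_map n i2 _).
  by rewrite [ext_quot_pi n c w]wx !xP subrr.
apply: generated_ind => _ [z -> z0]; apply/asboolP/span_gen.
rewrite /= tens_map_pure; eexists; first by [].
by move=> b /= ba; rewrite ffunE /p (negPf ba) cod_proj z0.
Qed.

Lemma inverse_limit_eq (x y : inverse_limit (@ext_quot_map n A)) :
  (forall c, sval x c = sval y c) -> x = y.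
Proof.
case: x y => [x xP] [y yP] /= xy; apply: eq_exist.
exact: functional_extensionality_dep.
Qed.

(** The inverse of evaluation at c: a value y is transported to c' along any morphism from c. Such
    morphisms exist because c has a basis, and [ext_quot_map_homotopy] makes the choice immaterial,
    which gives compatibility. *)
Lemma lim_val_limit (c : free_ext A) (e : A -> ext_mid c) :
  (0 < n)%N -> is_basis e -> (forall a, ext_proj c (e a) = a) ->
  exists phi : lim_val_type c n -> inverse_limit (@ext_quot_map n A),
    {morph phi : x y / x + y >-> inverse_limit_add x y} /\ bijective phi.
Proof.
move=> n0 eB eE.
have exh c' : exists h : ext_hom c c', True.
  have [g gE] := choice (@ext_proj_surj _ c').
  have [|h _] := @ext_hom_based _ c c' e g eB; last by exists h.
  by move=> a; rewrite gE eE.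
pose h c' : ext_hom c c' := sval (cid (exh c')).
have compat (y : lim_val_type c n) c1 c2 (u : ext_hom c1 c2) :
    ext_quot_map n u (ext_quot_map n (h c1) (val y)) =
    ext_quot_map n (h c2) (val y).
  rewrite -ext_quot_map_comp; apply: ext_quot_map_homotopy => //.
  exact: (valP y).
have h_id (y : ext_quot n c) : y \in lim_val c n -> ext_quot_map n (h c) y = y.
  by move=> yL; rewrite (ext_quot_map_homotopy _ (ext_id c)) // ext_quot_map_id.
exists (fun y => exist _ (fun c' => ext_quot_map n (h c') (val y)) (compat y)).
split=> [x y|].
  by apply: inverse_limit_eq => c' /=; rewrite !raddfD.
apply: inj_surj_bij => [x y /(congr1 (fun z => sval z c)) /=|x].
  by rewrite !h_id ?(valP x) ?(valP y) // => xy; apply: val_inj.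
have xL := limit_in_lim_val eB eE (svalP x).
exists (Sub (sval x c) xL); apply: inverse_limit_eq => c' /=.
exact: (svalP x).
Qed.
End Extensions.

Theorem theorem3p1 (n : nat) (A : zmodType) (P : 'I_n -> flat_resolution A) :
  (2 <= n)%N ->
  exists phi : Tor_bracket P -> inverse_limit (@ext_quot_map n A),
    {morph phi : x y / x + y >-> inverse_limit_add x y} /\ bijective phi.
Proof.
case: n P => [|[|p]] // P _.
(* The same c, free on the set A, provides the resolution that computes Tor and the extension at
   which the limit is evaluated. *)
have [|c [e [eB eE]]] := @free_presentation A A id; first by move=> a; exists a.
have [phi [phiD phi_bij]] := lim_val_limit (ltn0Sn p.+1) eB eE.
have [psi psi_bij] : zmod_iso (Tor_bracket P) (lim_val_type c p.+2).
  apply: zmod_iso_trans (homology_replace P (fun=> ext_resolution c) _) _.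
  exact: homology_lim_val.
exists (phi \o psi); split; last exact: bij_comp.
by move=> x y /=; rewrite raddfD phiD.
Qed.
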